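(* For every $d\in\mathbb{N}$ there is a constant $M>0$ depending only on $d$ such that the following holds. Let $\vartheta_{E,-},\vartheta_{E,+},\vartheta_L>0$, let $\tilde A:\mathbb{R}^d\to\mathbb{R}^{d\times d}$ be symmetric-matrix valued and satisfy, for all $x,y,\xi\in\mathbb{R}^d$, $$\vartheta_{E,-}|\xi|^2\le\xi^T\tilde A(x)\xi\le\vartheta_{E,+}|\xi|^2,\qquad\|\tilde A(x)-\tilde A(y)\|_\infty\le\vartheta_L|x-y|,$$ let $F:\mathbb{R}^d\to\mathbb{R}^d$ be Lipschitz continuous, $A=\tilde A\circ F$, and let $H$ be the self-adjoint operator $-\operatorname{div}(A\nabla\,\cdot)$ in $L^2(\mathbb{R}^d)$ defined in the context. Let $\delta\in(0,\delta_0)$ with $\delta_0$ as in the context, let $Z$ be a $(1,\delta)$-equidistributed sequence, and $W=\mathbf{1}_{S_{\delta,Z}}$. Then, with $I=\bigl(-\infty,\ \tfrac12\delta^{M(1+\vartheta_{E,-}^{-2/3})}\bigr]$, $$\chi_I(H)\,W\,\chi_I(H)\ \ge\ \frac12\,\delta^{M\left(1+\vartheta_{E,-}^{-2/3}\right)}\,\chi_I(H).$$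
   Context: Notation: $|z|$ is the Euclidean norm, $\|M\|_\infty$ the row sum norm of a matrix, $B(\rho,x)=\{y\in\mathbb{R}^d:|y-x|<\rho\}$, $\Lambda_1(j)=(-1/2,1/2)^d+j$. $H$ is the self-adjoint operator in $L^2(\mathbb{R}^d)$ associated with the closed, symmetric, non-negative form $a(u,v)=\int_{\mathbb{R}^d}\sum_{i,j}a^{ij}\,\partial_iu\,\overline{\partial_jv}\,dx$, $u,v\in H^1(\mathbb{R}^d)$, where $A=(a^{ij})$ (no lower order terms: $b=c=0$). Definition of $\delta_0$: let $\Theta_E\ge1$ and $\Theta_L\ge0$ be an ellipticity and a Lipschitz constant of the coefficient matrix $A$ of $H$, i.e. $\Theta_E^{-1}|\xi|^2\le\xi^TA(x)\xi\le\Theta_E|\xi|^2$ and $\|A(x)-A(y)\|_\infty\le\Theta_L|x-y|$ for all $x,y,\xi\in\mathbb{R}^d$; then $\delta_0=\bigl(330\,d\,\mathrm{e}^2\,\Theta_E^{11/2}(\Theta_E+1)^{5/2}(\Theta_L+1)\bigr)^{-1}$. A sequence $Z=(z_j)_{j\in\mathbb{Z}^d}\subset\mathbb{R}^d$ is $(1,\delta)$-equidistributed if $B(\delta,z_j)\subset\Lambda_1(j)$ for all $j$; $S_{\delta,Z}=\bigcup_jB(\delta,z_j)$. *)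

(* Defs.v *)
From HB Require Import structures.
From mathcomp Require Import all_boot all_order all_algebra.
From mathcomp Require Import complex.
From mathcomp Require Import all_classical all_reals all_analysis.

Set Implicit Arguments.
Unset Strict Implicit.
Unset Printing Implicit Defensive.

Import Order.TTheory GRing.Theory Num.Theory.
Import numFieldNormedType.Exports.

Local Open Scope classical_set_scope.
Local Open Scope ring_scope.
Local Open Scope complex_scope.

Definition rV_display : measure_display.
Proof. exact. Qed.

Section measurable_rV.
Context {R : realType} {n : nat}.

Let coors : 'I_n -> 'rV[R]_n -> measurableTypeR R := fun i x => x ord0 i.

Let rV_set0 : g_sigma_preimage coors set0.
Proof. exact: sigma_algebra0. Qed.

Let rV_setC A : g_sigma_preimage coors A -> g_sigma_preimage coors (~` A).
Proof. exact: sigma_algebraC. Qed.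

Let rV_bigcup (F : _^nat) : (forall i, g_sigma_preimage coors (F i)) ->
  g_sigma_preimage coors (\bigcup_i (F i)).
Proof. exact: sigma_algebra_bigcup. Qed.

HB.instance Definition _ := @isMeasurable.Build rV_display
  'rV[R]_n (g_sigma_preimage coors) rV_set0 rV_setC rV_bigcup.

End measurable_rV.

Section cons_rV.
Context {R : realType}.

Lemma measurable_coord n (i : 'I_n) :
  measurable_fun [set: 'rV[R]_n] (fun x => x ord0 i : measurableTypeR R).
Proof.
move=> _ Y mY; rewrite setTI; apply: sub_sigma_algebra => /=.
rewrite -bigcup_seq/=; exists i => /=; first by rewrite mem_index_enum.
by exists Y => //; rewrite setTI.
Qed.

Lemma measurable_fun_rVP d (T : measurableType d) n (f : T -> 'rV[R]_n) :
  (forall i, measurable_fun [set: T] (fun t => f t ord0 i : measurableTypeR R))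
  -> measurable_fun [set: T] f.
Proof.
move=> mf.
apply: (@measurability _ _ _ _ _ _
  (\big[setU/set0]_(i < n) preimage_set_system setT
     (fun x : 'rV[R]_n => x ord0 i : measurableTypeR R) measurable)) => //.
move=> _ [B + <-]; rewrite -bigcup_seq => -[i _ [C mC <-]].
rewrite !setTI; have := mf i measurableT C mC; rewrite setTI; exact.
Qed.

Definition cons_rV n (p : measurableTypeR R * 'rV[R]_n) : 'rV[R]_n.+1 :=
  \row_i (if unlift ord0 i is Some j then p.2 ord0 j else p.1).

Definition uncons_rV n (x : 'rV[R]_n.+1) : measurableTypeR R * 'rV[R]_n :=
  (x ord0 ord0, \row_j x ord0 (lift ord0 j)).

Lemma cons_rV0 n (p : measurableTypeR R * 'rV[R]_n) :
  cons_rV p ord0 ord0 = p.1.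
Proof. by rewrite mxE unlift_none. Qed.

Lemma cons_rVS n (p : measurableTypeR R * 'rV[R]_n) j :
  cons_rV p ord0 (lift ord0 j) = p.2 ord0 j.
Proof. by rewrite mxE liftK. Qed.

Lemma cons_rVK n : cancel (@cons_rV n) (@uncons_rV n).
Proof.
move=> p; rewrite /uncons_rV cons_rV0 [RHS]surjective_pairing; congr pair.
by apply/rowP => j; rewrite mxE cons_rVS.
Qed.

Lemma measurable_cons_rV n :
  measurable_fun [set: measurableTypeR R * 'rV[R]_n] (@cons_rV n).
Proof.
apply: measurable_fun_rVP => i; have [j ->|->] := unliftP ord0 i.
  under eq_fun do rewrite cons_rVS.
  exact: (measurableT_comp (measurable_coord j) measurable_snd).
under eq_fun do rewrite cons_rV0.
exact: measurable_fst.
Qed.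

Lemma measurable_uncons_rV n :
  measurable_fun [set: 'rV[R]_n.+1] (@uncons_rV n).
Proof.
apply/measurable_fun_pairP; split; first exact: measurable_coord.
apply: measurable_fun_rVP => i; rewrite /comp /=.
by under eq_fun do rewrite mxE; exact: measurable_coord.
Qed.

Section lebesgue_cons.
Context n (mu : {sigma_finite_measure set 'rV[R]_n -> \bar R}).

Definition lebesgue_cons : set 'rV[R]_n.+1 -> \bar R :=
  pushforward (lebesgue_measure \x mu)%E (@cons_rV n).

Let lebesgue_cons0 : lebesgue_cons set0 = 0%E.
Proof. by rewrite /lebesgue_cons /pushforward preimage_set0 measure0. Qed.

Let lebesgue_cons_ge0 A : (0 <= lebesgue_cons A)%E.
Proof. by rewrite /lebesgue_cons /pushforward; exact: measure_ge0. Qed.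

Let lebesgue_cons_sigma_additive : semi_sigma_additive lebesgue_cons.
Proof.
have mf := @measurable_cons_rV n.
exact: (@measure_semi_sigma_additive _ _ _ (pushforward _ _)).
Qed.

HB.instance Definition _ := isMeasure.Build _ _ _ lebesgue_cons
  lebesgue_cons0 lebesgue_cons_ge0 lebesgue_cons_sigma_additive.

Let lebesgue_cons_sigma_finite : sigma_finite setT lebesgue_cons.
Proof.
have /sigma_finiteP[F [TF ndF Foo]] := sigma_finiteT (@lebesgue_measure R).
have /sigma_finiteP[G [TG ndG Goo]] := sigma_finiteT mu.
exists (fun k => @uncons_rV n @^-1` (F k `*` G k)).
  rewrite -preimage_bigcup (_ : \bigcup_k _ = setT) ?preimage_setT//.
  apply/seteqP; split => // -[x y] _.
  have [k _ Fkx] : (\bigcup_i F i) x by rewrite -TF.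
  have [l _ Gly] : (\bigcup_i G i) y by rewrite -TG.
  exists (maxn k l) => //; split => /=.
    by move: x Fkx; exact/subsetPset/ndF/leq_maxl.
  by move: y Gly; exact/subsetPset/ndG/leq_maxr.
move=> k; have [mF Fk] := Foo k; have [mG Gk] := Goo k; split.
  rewrite -[X in measurable X]setTI; apply: measurable_uncons_rV => //.
  exact: measurableX.
rewrite /lebesgue_cons /pushforward -comp_preimage.
rewrite (_ : _ \o _ = idfun); last by apply/funext => p; exact: cons_rVK.
by rewrite preimage_id product_measure1E// lte_mul_pinfty// ge0_fin_numE.
Qed.

HB.instance Definition _ := Measure_isSigmaFinite.Build _ _ _ lebesgue_cons
  lebesgue_cons_sigma_finite.

End lebesgue_cons.
End cons_rV.

(* Lebesgue measure on the Borel sets of R^n: the image of the iterated product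
   of the one-dimensional Lebesgue measure, R^0 carrying the unit mass. *)
Fixpoint lebesgue_rV {R : realType} (n : nat) :
    {sigma_finite_measure set 'rV[R]_n -> \bar R} :=
  if n is m.+1 then lebesgue_cons (lebesgue_rV m) else \d_(0 : 'rV[R]_0).

Lemma lebesgue_rV_box {R : realType} n (B : 'I_n -> set (measurableTypeR R)) :
  (forall i, measurable (B i)) ->
  lebesgue_rV n [set x | forall i, B i (x ord0 i)] =
  (\prod_(i < n) lebesgue_measure (B i))%E.
Proof.
elim: n B => [|n IHn] B mB.
  by rewrite big_ord0 /= diracE mem_set// => -[].
rewrite big_ord_recl -IHn; last by move=> i; exact: mB.
pose D := [set x : 'rV[R]_n | forall i, B (lift ord0 i) (x ord0 i)].
rewrite -/D.
have mD : measurable D.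
  rewrite (_ : D = \bigcap_i ((fun x : 'rV[R]_n =>
      x ord0 i : measurableTypeR R) @^-1` B (lift ord0 i))).
    apply: fin_bigcap_measurable => // i _.
    by rewrite -[X in measurable X]setTI; exact: measurable_coord.
  by apply/seteqP; split => x /= Dx i; [move=> _|]; exact: Dx.
rewrite -(@product_measure1E _ _ _ _ R lebesgue_measure (lebesgue_rV n))//.
congr (product_measure1 _ _ _); apply/seteqP; split => p /=.
  move=> Bp; split; first by rewrite -(cons_rV0 p).
  by move=> i; rewrite -cons_rVS.
move=> [B0 BS] i; have [j ->|->] := unliftP ord0 i.
  by rewrite cons_rVS; exact: BS.
by rewrite cons_rV0.
Qed.

Section euclidean.
Context {R : realType}.

Definition euclid n (x : 'rV[R]_n) : R := Num.sqrt (\sum_i x ord0 i ^+ 2).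

Definition euclid_ball n (rho : R) (x : 'rV[R]_n) : set 'rV[R]_n :=
  [set y | euclid (y - x) < rho].

Definition row_sum_norm n (M : 'M[R]_n) : R :=
  \big[Num.max/0]_i \sum_j `|M i j|.

Definition unit_cube n (j : 'rV[int]_n) : set 'rV[R]_n :=
  [set x | forall i, - 2^-1 < x ord0 i - (j ord0 i)%:~R < 2^-1].

Definition equidistributed n (delta : R) (Z : 'rV[int]_n -> 'rV[R]_n) : Prop :=
  forall j, euclid_ball delta (Z j) `<=` unit_cube j.

Definition equidistributed_set n (delta : R) (Z : 'rV[int]_n -> 'rV[R]_n) :
  set 'rV[R]_n := \bigcup_j euclid_ball delta (Z j).

Definition lipschitz_euclid m n (F : 'rV[R]_m -> 'rV[R]_n) : Prop :=
  exists L : R, forall x y, euclid (F x - F y) <= L * euclid (x - y).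

Definition quadratic_bounds n (lo hi : R) (A : 'rV[R]_n -> 'M[R]_n) : Prop :=
  forall x xi, lo * euclid xi ^+ 2 <= (xi *m A x *m xi^T) ord0 ord0
               <= hi * euclid xi ^+ 2.

Definition lipschitz_matrix n (L : R) (A : 'rV[R]_n -> 'M[R]_n) : Prop :=
  forall x y, row_sum_norm (A x - A y) <= L * euclid (x - y).

Definition ellipticity_constant n (A : 'rV[R]_n -> 'M[R]_n) (Theta : R) : Prop :=
  1 <= Theta /\ quadratic_bounds Theta^-1 Theta A.

Definition lipschitz_constant n (A : 'rV[R]_n -> 'M[R]_n) (Theta : R) : Prop :=
  0 <= Theta /\ lipschitz_matrix Theta A.

Definition delta0 (d : nat) (ThetaE ThetaL : R) : R :=
  (330 * d%:R * expR 2 * ThetaE `^ (11 / 2) * (ThetaE + 1) `^ (5 / 2)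
   * (ThetaL + 1))^-1.

End euclidean.

(* The Hilbert space L^2(R^n; C) is handled through representatives: its
   elements are the functions u with [L2 u], two of them being identified when
   they are equal almost everywhere. *)
Section L2.
Context {R : realType} {n : nat}.
Local Notation mu := (lebesgue_rV n).
Implicit Types u v f : 'rV[R]_n -> R[i].

Definition cmeasurable u : Prop :=
  measurable_fun setT (fun x => complex.Re (u x)) /\
  measurable_fun setT (fun x => complex.Im (u x)).

Definition cintegral u : R[i] :=
  (\int[mu]_x complex.Re (u x)) +i* (\int[mu]_x complex.Im (u x)).

Definition L2 u : Prop :=
  cmeasurable u /\ (\int[mu]_x (complex.Re `|u x| ^+ 2)%:E < +oo)%E.

Definition inner u v : R[i] := cintegral (fun x => u x * (v x)^*).

(* x <= y on R[i] means that y - x is a nonnegative real number. *)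
Definition op_le (S T : ('rV[R]_n -> R[i]) -> 'rV[R]_n -> R[i]) : Prop :=
  forall f, L2 f -> inner (S f) f <= inner (T f) f.

Definition mult_indicator (S : set 'rV[R]_n) f : 'rV[R]_n -> R[i] :=
  fun x => (\1_S x)%:C * f x.

End L2.

Section sobolev.
Context {R : realType} {n : nat}.
Implicit Types (u v f w : 'rV[R]_n -> R[i]) (phi : 'rV[R]_n -> R).

Definition partial (i : 'I_n) phi : 'rV[R]_n -> R :=
  fun x => 'D_(delta_mx ord0 i) phi x.

Definition smooth phi : Prop :=
  forall s : seq 'I_n, let psi := foldr partial phi s in
    continuous psi /\ forall i x, derivable psi x (delta_mx ord0 i).

Definition test_function phi : Prop :=
  smooth phi /\ compact (closure [set x | phi x != 0]).

Definition weak_partial (i : 'I_n) u w : Prop :=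
  forall phi, test_function phi ->
    cintegral (fun x => u x * (partial i phi x)%:C) =
    - cintegral (fun x => w x * (phi x)%:C).

Definition H1 u : Prop :=
  L2 u /\ forall i, exists2 w, L2 w & weak_partial i u w.

(* Determined up to equality almost everywhere when u is in H^1. *)
Definition dH1 (i : 'I_n) u : 'rV[R]_n -> R[i] :=
  xget (fun=> 0) [set w | L2 w /\ weak_partial i u w].

Definition form (A : 'rV[R]_n -> 'M[R]_n) u v : R[i] :=
  cintegral (fun x =>
    \sum_i \sum_j (A x i j)%:C * dH1 i u x * (dH1 j v x)^*).

(* Graph of the operator associated with the form: u is in its domain and is
   mapped to f. *)
Definition divergence_operator (A : 'rV[R]_n -> 'M[R]_n) u f : Prop :=
  [/\ H1 u, L2 f & forall v, H1 v -> form A u v = inner f v].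

End sobolev.

Section spectral.
Context {R : realType} {n : nat}.
Local Notation fn := ('rV[R]_n -> R[i]).
Local Notation mu := (@lebesgue_rV R n).

(* Projection-valued measures on the Borel sets of the line.  [pvm_measure u]
   is the scalar measure B |-> <E(B) u, u>, whose existence as a measure is the
   (weak, equivalently strong) countable additivity of E. *)
Record pvm := {
  pvm_fun :> set (measurableTypeR R) -> fn -> fn ;
  pvm_measure : fn -> {measure set (measurableTypeR R) -> \bar R} ;
  pvm_L2 : forall B u, measurable B -> L2 u -> L2 (pvm_fun B u) ;
  pvm_linear : forall B (a : R[i]) u v, measurable B -> L2 u -> L2 v ->
    pvm_fun B (fun x => a * u x + v x) =
    (fun x => a * pvm_fun B u x + pvm_fun B v x) %[ae mu] ;
  pvm_selfadjoint : forall B u v, measurable B -> L2 u -> L2 v ->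
    inner (pvm_fun B u) v = inner u (pvm_fun B v) ;
  pvm_setI : forall B C u, measurable B -> measurable C -> L2 u ->
    pvm_fun (B `&` C) u = pvm_fun B (pvm_fun C u) %[ae mu] ;
  pvm_setT : forall u, L2 u -> pvm_fun setT u = u %[ae mu] ;
  pvm_measureE : forall B u, measurable B -> L2 u ->
    pvm_measure u B = (complex.Re (inner (pvm_fun B u) u))%:E
}.

(* H = \int t dE(t), for H given by its graph: the domain of H consists of the u
   for which t^2 is integrable against <E(.) u, u>, and <H u, u> is there the
   integral of t; by polarization this determines H u. *)
Definition spectral_resolution (H : fn -> fn -> Prop) (E : pvm) : Prop :=
  (forall u, L2 u ->
    (exists f, H u f) <-> (\int[pvm_measure E u]_t (t ^+ 2)%:E < +oo)%E) /\
  (forall u f, H u f -> inner f u = (\int[pvm_measure E u]_t t)%:C).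

End spectral.

(* Main.v *)
Require Import Defs.
From HB Require Import structures.
From mathcomp Require Import all_boot all_order all_algebra.
From mathcomp Require Import complex.
From mathcomp Require Import all_classical all_reals all_analysis.
From mathcomp Require Import measurable_realfun.
From mathcomp Require Import ring lra.

(** The constant M may depend on the dimension, and the energies concerned are at
    most delta^M. At energies as small as this, a function u in the range of the
    spectral projection onto I is nearly constant on unit cells, and a Poincare
    inequality shows that it cannot avoid the balls.

    Energy. The form is nonnegative, so the spectral measure of u is carried by
    [0, kappa] ([pvm_measure_neg]); hence u lies in the domain and its energy is
    at most kappa |u|^2 ([low_energy]). By ellipticity the squared norm of its
    gradient is at most Theta_E kappa |u|^2 ([ellipticity_gradient]).

    Poincare inequality. For u in H^1, the bound
    u(x)^2 <= 2 u(y)^2 + 2 (u(y) - u(x))^2 is integrated over all pairs where y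
    lies in a small cube about the point z_j that belongs to the unit cell of x.
    Such a y lies in S and its distance to x is at most 1 in each coordinate,
    so the last term is controlled by norms of u(. + h) - u with |h_i| <= 1.
    The result ([poincare]) bounds (delta/d)^d |u|^2 by constants times the mass
    of u on S and the squared norm of the gradient.

    Translation estimate. The norm of u(. + s e_i) - u is at most |s| times the
    norm of the weak derivative w ([translation_le]). For this, the weak
    derivative is tested with smooth products that approximate the time spent by
    a point in a box moving along e_i; in the limit ([weak_partial_sweep]) one
    obtains that u(. + s e_i) - u and the integral of w along the segment have
    the same integral over every box. Hence they agree almost everywhere
    ([weak_partial_balance]), and Cauchy-Schwarz concludes.

    Absorption. Since delta < delta0, the dimension and Theta_E are bounded by
    1 / delta ([delta0_le]), so that with M = 4 d + 10 the gradient term in the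
    Poincare inequality is at most half of the left-hand side
    ([absorb_gradient], [low_energy_observability]). *)

Set Implicit Arguments.
Unset Strict Implicit.
Unset Printing Implicit Defensive.

Import Order.TTheory GRing.Theory Num.Theory.
Import numFieldNormedType.Exports.

Local Open Scope classical_set_scope.
Local Open Scope ring_scope.

(** * Smooth functions on the line *)

Section smooth_line.
Context {R : realType}.
Implicit Types (f g : R -> R) (p : {poly R}).

(** Existence of n successive derivatives. Continuity is never part of the
    condition: it follows from differentiability one level up. *)
Fixpoint Cn (n : nat) f : Prop :=
  if n is m.+1 then (forall x : R, derivable f x (1 : R)) /\ Cn m (derive1 f) else True.

Definition smooth1 f : Prop := forall n, Cn n f.

Lemma CnS n f g : (forall x : R, is_derive x (1 : R) f (g x)) -> Cn n g -> Cn n.+1 f.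
Proof.
move=> df Cg; split=> [x|]; first by have [] := df x.
suff -> : (derive1 f) = g by [].
by apply/funext => x; rewrite derive1E; have [_ ->] := df x.
Qed.

Lemma CnW n f : Cn n.+1 f -> Cn n f.
Proof. by elim: n f => // n IHn f [df Cf]; split=> //; exact: IHn. Qed.

Lemma Cn_is_derive n f : Cn n.+1 f -> forall x : R, is_derive x (1 : R) f (derive1 f x).
Proof. by move=> [df _] x; rewrite derive1E; exact: derivableP. Qed.

Lemma smooth1_is_derive f : smooth1 f -> forall x : R, is_derive x (1 : R) f (derive1 f x).
Proof. by move=> sf; exact: (Cn_is_derive (sf 1%N)). Qed.

Lemma smooth1_derive1 f : smooth1 f -> smooth1 (derive1 f).
Proof. by move=> sf n; exact: (sf n.+1).2. Qed.

Lemma smooth1_continuous f : smooth1 f -> continuous f.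
Proof.
move=> sf x; apply: differentiable_continuous; apply/derivable1_diffP.
exact: (sf 1%N).1.
Qed.

Lemma Cn_cst n (a : R) : Cn n (fun=> a).
Proof.
elim: n a => // n IHn a; exact: CnS (IHn 0).
Qed.

Lemma CnD n f g : Cn n f -> Cn n g -> Cn n (fun x => f x + g x).
Proof.
elim: n f g => // n IHn f g Cf Cg; apply: (CnS _ (IHn _ _ Cf.2 Cg.2)) => x.
by apply: is_deriveD; [exact: (Cn_is_derive Cf)|exact: (Cn_is_derive Cg)].
Qed.

Lemma CnM n f g : Cn n f -> Cn n g -> Cn n (fun x => f x * g x).
Proof.
elim: n f g => // n IHn f g Cf Cg.
have CM := CnD (IHn _ _ (CnW Cf) Cg.2) (IHn _ _ (CnW Cg) Cf.2).
apply: (CnS _ CM) => x.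
by apply: is_deriveM; [exact: (Cn_is_derive Cf)|exact: (Cn_is_derive Cg)].
Qed.

Lemma CnV n f : (forall x, f x != 0) -> Cn n f -> Cn n (fun x => (f x)^-1).
Proof.
elim: n f => // n IHn f f0 Cf; have CV := IHn _ f0 (CnW Cf).
have C := CnM (CnM (Cn_cst n (-1)) Cf.2) (CnM CV CV).
apply: (CnS _ C) => x; apply: is_derive_eq.
  by apply: is_deriveV => //; exact: (Cn_is_derive Cf).
by rewrite /GRing.scale /= expr2 invfM; ring.
Qed.

Lemma Cn_affine n f (a b : R) : Cn n f -> Cn n (fun x => f (a * x + b)).
Proof.
elim: n f => // n IHn f Cf; apply: (CnS _ (CnM (IHn _ Cf.2) (Cn_cst n a))) => x.
apply: (@is_derive1_comp _ f (fun y => a * y + b)).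
  exact: (Cn_is_derive Cf).
apply: (@is_derive_eq _ _ _ _ _ _ _ (a *: (1 : R) + 0)).
by rewrite /GRing.scale /= mulr1 addr0.
Qed.

(** The extension by 0 of p(1/x) exp(-1/x). With the polynomial p as a
    parameter the family is closed under differentiation, so one derivative
    computation gives smoothness. *)
Definition expinv p (x : R) : R :=
  if 0 < x then p.[x^-1] * expR (- x^-1) else 0.

Lemma horner_le_pow p : exists2 K, 0 <= K &
  forall y, 1 <= y -> `|p.[y]| <= K * y ^+ (size p).
Proof.
exists (\sum_(i < size p) `|p`_i|) => [|y y1]; first exact: sumr_ge0.
rewrite horner_coef (le_trans (ler_norm_sum _ _ _))// mulr_suml.
apply: ler_sum => i _; rewrite normrM ler_wpM2l// normrX ger0_norm ?(le_trans _ y1)//.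
by rewrite ler_weXn2l// ltnW.
Qed.

(** The exponential series bounds exp(-1/x) by any power of x; one that beats
    p(1/x) by two orders makes the difference quotient at 0 vanish. *)
Lemma expinv_le_sqr p : exists2 K, 0 <= K &
  forall x, x <= 1 -> `|expinv p x| <= K * x ^+ 2.
Proof.
have [K K0 pK] := horner_le_pow p.
pose m := (size p).+1.
(* The term of order size p + 2 of the exponential series is the one used. *)
exists (K * (m.+1)`!%:R) => [|x x1]; first by rewrite mulr_ge0.
rewrite /expinv; case: ifPn => x0; last first.
  by rewrite normr0; apply: mulr_ge0; [apply: mulr_ge0|exact: sqr_ge0].
have y1 : 1 <= x^-1 by rewrite invf_ge1.
have y0 : 0 < x^-1 by rewrite invr_gt0.
rewrite normrM (ger0_norm (expR_ge0 _)) expRN.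
rewrite ler_pdivrMr ?expR_gt0//; apply: (le_trans (pK _ y1)).
rewrite -!mulrA ler_wpM2l//.
have := expR_ge1Dxn m (ltW y0); rewrite addrC => /(le_trans _) H.
have {H} : x^-1 ^+ m.+1 / m.+1`!%:R <= expR x^-1.
  by apply: le_trans (expR_ge1Dxn m (ltW y0)); rewrite lerDr.
rewrite ler_pdivrMr ?ltr0n ?fact_gt0// => H.
have -> : x^-1 ^+ size p = x ^+ 2 * x^-1 ^+ m.+1.
  by rewrite /m !exprS expr0; field; rewrite gt_eqF.
apply: (le_trans (ler_wpM2l (sqr_ge0 x) H)).
by rewrite le_eqVlt; apply/orP; left; apply/eqP; ring.
Qed.

(** At positive x this is the chain rule; at 0 the difference quotient is O(x)
    by the quadratic bound. *)
Lemma is_derive_expinv p (x : R) :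
  is_derive x (1 : R) (expinv p) (expinv ('X^2 * (p - p^`())) x).
Proof.
have [x0|x0|->] := ltgtP x 0.
- rewrite [X in is_derive _ _ _ X](_ : _ = 0); last by rewrite /expinv ltNge ltW.
  apply: (@near_eq_is_derive _ _ _ (cst 0)) => //.
  near=> y; rewrite /expinv /= ltNge [y <= 0]ltW//.
  by near: y; exact: lt_nbhsl.
- apply: (@near_eq_is_derive R R R (fun y : R => p.[y^-1] * expR (- y^-1))) => //.
    near=> y; rewrite /expinv ifT//.
    by near: y; exact: lt_nbhsr.
  have dV : is_derive x (1 : R) (fun y : R => y^-1) (- x ^- 2).
    by apply: is_derive_eq; [apply: is_deriveV; rewrite ?gt_eqF//|rewrite /GRing.scale/= mulr1].
  have dN : is_derive x (1 : R) (fun y : R => - y^-1) (x ^- 2).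
    by apply: is_derive_eq; rewrite opprK.
  apply: is_derive_eq.
  rewrite /expinv x0 !hornerE /GRing.scale /= exprVn; ring.
rewrite [X in is_derive _ _ _ X](_ : _ = 0); last by rewrite /expinv ltxx.
have [K K0 pK] := expinv_le_sqr p.
(* At 0 the quotient is bounded by K |h|. *)
suff cv : (fun h => h^-1 *: ((expinv p \o shift 0) (h *: 1) - expinv p 0)) @ 0^' --> (0:R).
  apply: DeriveDef; first by apply/cvg_ex; exists 0.
  exact: cvg_lim cv.
apply/cvgr0Pnorm_le => e e0; near=> h.
have h0 : h != 0 by near: h; exact: nbhs_dnbhs_neq.
rewrite /= /GRing.scale /= mulr1 addr0 {2}/expinv ltxx subr0 normrM normfV.
rewrite ler_pdivrMl ?normr_gt0//.
have h1 : `|h| <= 1 by near: h; apply: dnbhs0_le.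
apply: (le_trans (pK _ (le_trans (ler_norm _) h1))).
rewrite -real_normK ?num_real// expr2 mulrA mulrC ler_wpM2l//.
have hK : `|h| <= e / (K + 1).
  by near: h; apply: dnbhs0_le; rewrite divr_gt0// ltr_pwDr.
apply: (@le_trans _ _ ((K + 1) * `|h|)); first by rewrite ler_wpM2r// lerDl.
by rewrite mulrC -ler_pdivlMr// ltr_pwDr.
Unshelve. all: by end_near. Qed.

Lemma smooth1_expinv p : smooth1 (expinv p).
Proof.
by move=> n; elim: n p => // n IHn p; exact: (CnS (is_derive_expinv p)).
Qed.

(** A quotient of flat functions: each of them vanishes to infinite order where
    the other one must take over, which leaves a smooth transition from 0 to 1. *)
Definition step (x : R) : R :=
  expinv 1 x / (expinv 1 x + expinv 1 (1 - x)).

Lemma expinv1_ge0 x : 0 <= expinv 1 x.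
Proof. by rewrite /expinv; case: ifP => // _; rewrite hornerE mul1r expR_ge0. Qed.

Lemma expinv1_gt0 x : 0 < x -> 0 < expinv 1 x.
Proof. by rewrite /expinv => ->; rewrite hornerE mul1r expR_gt0. Qed.

Lemma expinv_le0 p x : x <= 0 -> expinv p x = 0.
Proof. by rewrite /expinv ltNge => ->. Qed.

Lemma step_den_gt0 x : 0 < expinv 1 x + expinv 1 (1 - x).
Proof.
have [x0|x0] := ltP 0 x.
  by rewrite ltr_wpDr ?expinv1_ge0// expinv1_gt0.
by rewrite ltr_wpDl ?expinv1_ge0// expinv1_gt0//; lra.
Qed.

Lemma smooth1_step : smooth1 step.
Proof.
move=> n; apply: CnM; first exact: smooth1_expinv.
apply: CnV => [x|]; first by rewrite gt_eqF// step_den_gt0.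
apply: CnD; first exact: smooth1_expinv.
rewrite (_ : (fun x => _) = (fun x => expinv 1 (-1 * x + 1))).
  by apply: Cn_affine; exact: smooth1_expinv.
by apply/funext => x; congr expinv; ring.
Qed.

Lemma step_le0 x : x <= 0 -> step x = 0.
Proof. by move=> x0; rewrite /step expinv_le0// mul0r. Qed.

Lemma step_ge1 x : 1 <= x -> step x = 1.
Proof.
move=> x1; have x0 : 0 < x by lra.
rewrite /step (@expinv_le0 1 (1 - x)); last by lra.
by rewrite addr0 divff// gt_eqF// expinv1_gt0.
Qed.

Lemma step_ge0 x : 0 <= step x.
Proof. by rewrite divr_ge0 ?expinv1_ge0// ltW// step_den_gt0. Qed.

Lemma step_le1 x : step x <= 1.
Proof. by rewrite ler_pdivrMr ?step_den_gt0// mul1r lerDl expinv1_ge0. Qed.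

(** Unlike a primitive of [step], this product is explicit and still agrees with
    the positive part outside ]0, 1[. Rescaling it gives the positive part, and
    rescaling its derivative gives the Heaviside function. *)
Definition ramp (x : R) : R := x * step x.

Lemma smooth1_ramp : smooth1 ramp.
Proof.
move=> n; apply: CnM; last exact: smooth1_step.
case: n => // n; exact: (@CnS _ _ (fun=> 1) _ (Cn_cst _ _)).
Qed.

Lemma ramp_le0 x : x <= 0 -> ramp x = 0.
Proof. by move=> x0; rewrite /ramp step_le0// mulr0. Qed.

Lemma ramp_ge1 x : 1 <= x -> ramp x = x.
Proof. by move=> x0; rewrite /ramp step_ge1// mulr1. Qed.

Lemma derive_ramp_le0 x : x <= 0 -> derive1 ramp x = 0.
Proof.
rewrite le_eqVlt => /predU1P[->|x0].
  rewrite derive1E; apply: (@derive_val _ _ _ _ _ _ 0).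
  have dS : is_derive (0 : R) (1 : R) step (derive1 step 0) by exact: smooth1_is_derive smooth1_step 0.
  have := is_deriveM (is_derive_id (0 : R) (1 : R)) dS.
  move/is_derive_eq; apply.
  by rewrite /GRing.scale /= step_le0// mul0r mulr1 addr0.
rewrite derive1E; apply: (@derive_val _ _ _ _ _ _ 0).
apply: (@near_eq_is_derive _ _ _ (cst 0)) => //.
near=> y; rewrite /= ramp_le0// ltW//.
by near: y; exact: lt_nbhsl.
Unshelve. all: by end_near. Qed.

Lemma derive_ramp_gt1 x : 1 < x -> derive1 ramp x = 1.
Proof.
move=> x1.
rewrite derive1E; apply: (@derive_val _ _ _ _ _ _ (1 : R)).
apply: (@near_eq_is_derive _ _ _ id) => //.
near=> y; rewrite /= ramp_ge1// ltW//.
by near: y; exact: lt_nbhsr.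
Unshelve. all: by end_near. Qed.

(** The derivative is constant outside [0, 2] and continuous on it. Domination of
    the rescaled derivatives needs such a uniform bound. *)
Lemma derive_ramp_bounded : exists2 K, 0 <= K & forall x, `|derive1 ramp x| <= K.
Proof.
have sr : smooth1 (derive1 ramp) by exact: smooth1_derive1 smooth1_ramp.
have cr : {within `[0, 2], continuous (fun x => `|derive1 ramp x|)}.
  apply: continuous_subspaceT => x; apply: continuous_comp.
    exact: smooth1_continuous.
  exact: norm_continuous.
have [c _ cm] := @EVT_max _ (fun x => `|derive1 ramp x|) 0 2 ltac:(lra) cr.
exists (`|derive1 ramp c| + 1) => [|x]; first by rewrite addr_ge0.
have [x0|x0] := leP x 0; first by rewrite derive_ramp_le0// normr0 addr_ge0.
have [x1|x1] := ltP 1 x; first by rewrite derive_ramp_gt1// normr1 lerDr.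
rewrite ler_wpDr// cm// in_itv/=; lra.
Qed.

End smooth_line.

(** * Boxes and translations *)

Section box_measure.
Context {R : realType} {n : nat}.
Local Notation T := 'rV[R]_n.
Local Notation mu := (lebesgue_rV n : {sigma_finite_measure set T -> \bar R}).

Definition box (a b : T) : set T := [set x | forall i, x ord0 i \in `]a ord0 i, b ord0 i]].

Definition boxes : set_system T := [set B | exists a b, B = box a b].

Lemma measurable_box a b : measurable (box a b).
Proof.
have -> : box a b = \bigcap_(i in [set: 'I_n])
    ((fun x : T => x ord0 i : measurableTypeR R) @^-1` `]a ord0 i, b ord0 i]).
  by apply/seteqP; split=> x Bx => [i _|i]; exact: Bx.
apply: fin_bigcap_measurable => // i _.
by rewrite -[X in measurable X]setTI; exact: measurable_coord.
Qed.

Definition cube_of_radius (k : nat) : set T := box (const_mx (- k%:R)) (const_mx k%:R).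

Lemma bigcup_cube_of_radius : \bigcup_k cube_of_radius k = setT.
Proof.
apply/seteqP; split=> // x _.
pose r := \sum_i `|x ord0 i|.
have [k rk] : exists k : nat, r < k%:R.
  by exists (Num.truncn r).+1; exact: truncnS_gt.
exists k => // i; rewrite in_itv /= !mxE.
have xr : `|x ord0 i| <= r by rewrite /r (bigD1 i)//= lerDl sumr_ge0.
have := ler_norm (x ord0 i); have := ler_norm (- x ord0 i); rewrite normrN.
by move=> h1 h2; apply/andP; split; lra.
Qed.

Lemma box_generates : @measurable _ T = <<s boxes>>.
Proof.
apply/seteqP; split; last first.
  apply: smallest_sub; first exact: sigma_algebra_measurable.
  by move=> _ [a [b ->]]; exact: measurable_box.
apply: smallest_sub; first exact: smallest_sigma_algebra.
move=> A; rewrite -bigcup_seq => -[i _ [C mC <-]].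
pose f : g_sigma_algebraType boxes -> measurableTypeR R := fun x : T => x ord0 i.
have : measurable_fun setT f; last exact.
apply: (@measurability _ _ _ _ setT f (@ocitv R)) => //.
move=> _ [_ [[a b] _ <-] <-] /=.
pose upd (s r : R) : T := \row_j (if j == i then r else s).
(* A slab is an increasing union of boxes that are long in the other directions. *)
have -> : setT `&` f @^-1` `]a, b] = \bigcup_k box (upd (- k%:R) a) (upd k%:R b).
  apply/seteqP; split=> [x [_ /= abx]|x [k _ Bx]]; last first.
    by split=> //=; have := Bx i; rewrite !mxE eqxx.
  have : (\bigcup_k cube_of_radius k) x by rewrite bigcup_cube_of_radius.
  move=> [k _ Bx]; exists k => // j; have := Bx j; rewrite !mxE.
  by case: eqP => // ->.
apply: (@bigcupT_measurable _ (g_sigma_algebraType boxes)) => k.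
by apply: sub_sigma_algebra; eexists; eexists; reflexivity.
Qed.

Lemma setI_boxes : setI_closed boxes.
Proof.
move=> _ _ [a [b ->]] [a' [b' ->]].
exists (\row_i Num.max (a ord0 i) (a' ord0 i)).
exists (\row_i Num.min (b ord0 i) (b' ord0 i)).
apply/seteqP; split=> x.
  move=> [Bx B'x] i; rewrite in_itv/= !mxE gt_max le_min.
  have := Bx i; have := B'x i; rewrite !in_itv/=.
  by move=> /andP[-> ->] /andP[-> ->].
by move=> Bx; split=> i; have := Bx i; rewrite !in_itv/= !mxE gt_max le_min;
  move=> /andP[/andP[h1 h2] /andP[h3 h4]]; apply/andP.
Qed.

(** Boxes are stable under intersection, generate the Borel sets and contain an
    exhausting sequence, so a measure finite on cubes is determined by its values
    on boxes. *)
Lemma box_measure_unique (m1 m2 : {measure set T -> \bar R}) :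
  (forall a b, m1 (box a b) = m2 (box a b)) ->
  (forall k, m1 (cube_of_radius k) < +oo)%E ->
  forall A, measurable A -> m1 A = m2 A.
Proof.
move=> m12 m1oo; apply: (measure_unique boxes cube_of_radius) => //.
- exact: box_generates.
- exact: setI_boxes.
- by move=> k; eexists; eexists; reflexivity.
- exact: bigcup_cube_of_radius.
- by move=> _ [a [b ->]].
Qed.

Lemma lebesgue_boxE (a b : T) :
  mu (box a b) = (\prod_(i < n) lebesgue_measure `]a ord0 i, b ord0 i]%classic)%E.
Proof.
exact: (@lebesgue_rV_box R n (fun i => `]a ord0 i, b ord0 i]%classic)).
Qed.

Lemma lebesgue_box (a b : T) : (forall i, a ord0 i <= b ord0 i) ->
  mu (box a b) = (\prod_(i < n) (b ord0 i - a ord0 i))%:E.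
Proof.
move=> ab; rewrite lebesgue_boxE -prodEFin; apply: eq_bigr => i _.
rewrite lebesgue_measure_itv/= lte_fin.
by have := ab i; rewrite le_eqVlt => /predU1P[->|->]//; rewrite ltxx subrr.
Qed.

Lemma lebesgue_cube_lty k : (mu (cube_of_radius k) < +oo)%E.
Proof. by rewrite lebesgue_box ?ltry// => i; rewrite !mxE; have := ler0n R k; lra. Qed.

Lemma measurable_shift (h : T) : measurable_fun setT (fun x : T => x + h).
Proof.
apply: measurable_fun_rVP => i; under eq_fun do rewrite mxE.
by apply: measurable_funD; [exact: measurable_coord|exact: measurable_cst].
Qed.

Lemma measurable_addv : measurable_fun setT (fun p : T * T => p.1 + p.2).
Proof.
apply: measurable_fun_rVP => i; under eq_fun do rewrite mxE.
by apply: measurable_funD; apply: (measurableT_comp (measurable_coord i)).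
Qed.

(** Side lengths are invariant under translation, and boxes determine a measure. *)
Lemma lebesgue_shift (h : T) A : measurable A ->
  mu ((fun x => x + h) @^-1` A) = mu A.
Proof.
move=> mA; have mh := measurable_shift h.
pose m2 : {measure set T -> \bar R} := pushforward mu (fun x : T => x + h).
suff : mu A = m2 mh A by [].
apply: box_measure_unique mA => [a b|]; last exact: lebesgue_cube_lty.
have -> : m2 mh (box a b) = mu (box (a - h) (b - h)).
  congr (mu _); apply/seteqP; split=> x Bx i; have := Bx i;
    rewrite !in_itv/= !mxE => /andP[h1 h2]; apply/andP; split; lra.
rewrite [LHS]lebesgue_boxE lebesgue_boxE.
apply: eq_bigr => i _; rewrite !lebesgue_measure_itv/= !lte_fin !mxE.
rewrite ltrD2r; case: ifP => // _; rewrite -!EFinB; congr EFin; ring.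
Qed.

Lemma integral_shift (h : T) (f : T -> \bar R) : measurable_fun setT f ->
  (forall x, 0 <= f x)%E ->
  (\int[mu]_x f (x + h)%R = \int[mu]_x f x)%E.
Proof.
move=> mf f0; have mh := measurable_shift h.
pose m2 : {measure set T -> \bar R} := pushforward mu (fun x : T => x + h).
transitivity (\int[m2 mh]_x f x)%E.
  by rewrite /m2 ge0_integral_pushforward//.
by apply: eq_measure_integral => A mA _; exact: lebesgue_shift.
Qed.

Definition floor_rV (x : T) : 'rV[int]_n := \row_i Num.floor (x ord0 i).

(** The integer part takes countably many values, so a function that factors
    through it is measurable whatever the other factor is. This covers both the
    choice of the centre belonging to a point and sampling on a grid. *)
Lemma measurable_floor_comp d (U : measurableType d) (g : 'rV[int]_n -> U) :
  measurable_fun setT (fun x => g (floor_rV x)).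
Proof.
move=> _ B mB; rewrite setTI.
have -> : (fun x => g (floor_rV x)) @^-1` B =
    \bigcup_(j in [set: 'rV[int]_n])
      (if g j \in B then [set x | floor_rV x = j] else set0).
  apply/seteqP; split=> [x Bx|x [j _]].
    by exists (floor_rV x) => //; rewrite ifT ?inE.
  by case: ifPn => [/set_mem Bj xj|_ []]; rewrite /preimage /= xj.
apply: countable_bigcupT_measurable; first exact: countableP.
move=> j; case: ifP => // _.
have -> : [set x | floor_rV x = j] = \bigcap_(i in [set: 'I_n])
    ((fun x : T => x ord0 i : measurableTypeR R) @^-1`
     `[(j ord0 i)%:~R, (j ord0 i + 1)%:~R[).
  apply/seteqP; split=> x.
    move=> <- i _ /=; rewrite in_itv/= mxE; apply/andP; split; first exact: floor_le.
    exact: floorD1_gt.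
  move=> H; apply/rowP => i; rewrite mxE; apply: floor_def.
  by have := H i I; rewrite /= in_itv.
apply: fin_bigcap_measurable => // i _.
by rewrite -[X in measurable X]setTI; exact: measurable_coord.
Qed.

End box_measure.

(** * Products of smooth functions as test functions *)

Section tensor.
Context {R : realType} {n : nat}.
Local Notation T := 'rV[R]_n.
Implicit Types (eta : 'I_n -> R -> R).

Definition tensor eta : T -> R := fun x => \prod_i eta i (x ord0 i).

(** The Leibniz rule for the partial derivative of a product of functions of
    distinct variables has a single term. *)
Definition dtensor eta (i : 'I_n) : 'I_n -> R -> R :=
  fun j => if j == i then derive1 (eta j) else eta j.

Lemma is_derive_tensor eta i (x : T) : (forall j, smooth1 (eta j)) ->
  is_derive x (delta_mx ord0 i) (tensor eta) (tensor (dtensor eta i) x).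
Proof.
move=> se; pose C := \prod_(j | j != i) eta j (x ord0 j).
have tE h : tensor eta (h *: delta_mx ord0 i + x) = C * eta i (h + x ord0 i).
  rewrite /tensor (bigD1 i)//= mulrC; congr (_ * eta i _).
    apply: eq_bigr => j ji; congr eta.
    by rewrite !mxE eqxx (negPf ji) mulr0 add0r.
  by rewrite !mxE !eqxx mulr1.
have dE : tensor (dtensor eta i) x = C * derive1 (eta i) (x ord0 i).
  rewrite /tensor (bigD1 i)//= mulrC; congr (_ * _); last by rewrite /dtensor eqxx.
  by apply: eq_bigr => j ji; rewrite /dtensor (negPf ji).
suff cv : (fun h => h^-1 *: ((tensor eta \o shift x) (h *: delta_mx ord0 i) - tensor eta x)) @ 0^'
    --> tensor (dtensor eta i) x.
  apply: DeriveDef; first by apply/cvg_ex; exists (tensor (dtensor eta i) x).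
  exact: cvg_lim cv.
rewrite dE.
have -> : (fun h => h^-1 *: ((tensor eta \o shift x) (h *: delta_mx ord0 i) - tensor eta x))
  = (fun h : R => C * (h^-1 *: ((eta i \o shift (x ord0 i)) (h *: 1) - eta i (x ord0 i)))).
  apply/funext => h /=; rewrite tE.
  have -> : tensor eta x = C * eta i (x ord0 i) by rewrite -[x in LHS]add0r -(scale0r (delta_mx ord0 i)) tE add0r.
  by rewrite /GRing.scale /= mulr1; ring.
have [dj dv] := smooth1_is_derive (se i) (x ord0 i).
apply: cvgM; first exact: cvg_cst.
by rewrite -dv; exact: dj.
Qed.

Lemma partial_tensor eta i : (forall j, smooth1 (eta j)) ->
  partial i (tensor eta) = tensor (dtensor eta i).
Proof.
by move=> se; apply/funext => x; have [_ <-] := is_derive_tensor i x se.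
Qed.

Lemma smooth1_dtensor eta i : (forall j, smooth1 (eta j)) ->
  forall j, smooth1 (dtensor eta i j).
Proof.
by move=> se j; rewrite /dtensor; case: ifP => // _; exact: smooth1_derive1.
Qed.

(** Products are closed under partial derivatives, so iterated partial derivatives
    need not be computed to be seen to exist. *)
Lemma foldr_partial_tensor eta s : (forall j, smooth1 (eta j)) ->
  exists2 eta', forall j, smooth1 (eta' j) &
    foldr partial (tensor eta) s = tensor eta'.
Proof.
move=> se; elim: s => [|i s [eta' se' IH]]; first by exists eta.
exists (dtensor eta' i); first exact: smooth1_dtensor.
by rewrite /= IH partial_tensor.
Qed.

Lemma continuous_tensor eta : (forall j, continuous (eta j)) ->
  continuous (tensor eta).
Proof.
move=> ce x; rewrite /tensor; elim: (index_enum _) => [|i r IH].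
  have -> : (fun y : T => \prod_(i <- [::]) eta i (y ord0 i)) = cst 1.
    by apply/funext => y; rewrite big_nil.
  exact: cst_continuous.
have -> : (fun y : T => \prod_(j <- i :: r) eta j (y ord0 j)) =
    (fun y => eta i (y ord0 i) * \prod_(j <- r) eta j (y ord0 j)).
  by apply/funext => y; rewrite big_cons.
apply: continuousM => //.
apply: (@continuous_comp _ _ _ (fun x : T => x ord0 i)); last exact: ce.
exact: coord_continuous.
Qed.

(** The support lies in a closed box, which is compact. *)
Lemma test_function_tensor eta (a b : T) : (forall j, smooth1 (eta j)) ->
  (forall j t, t \notin `]a ord0 j, b ord0 j] -> eta j t = 0) ->
  test_function (tensor eta).
Proof.
move=> se e0; split=> [s|].
  have [eta' se' ->] := foldr_partial_tensor s se; split.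
    by apply: continuous_tensor => j; exact: smooth1_continuous.
  by move=> i x; have [] := is_derive_tensor i x se'.
have K : compact [set x : T | forall i, `[a ord0 i, b ord0 i]%classic (x ord0 i)].
  by apply: (@rV_compact R n (fun i => `[a ord0 i, b ord0 i]%classic)) => i; exact: segment_compact.
apply: (subclosed_compact _ K); first exact: closed_closure.
have /closure_id -> := compact_closed (@norm_hausdorff _ _) K.
apply: closure_subset => x /= tx j; rewrite in_itv/=; move: tx.
apply: contraNP => xj; rewrite /tensor (bigD1 j)//= e0 ?mul0r//.
apply/negP; rewrite in_itv/= => /andP[h1 h2]; apply: xj; rewrite h2 ltW//.
Qed.

Lemma tensor_box eta (c : R) (a b : T) : (forall j t, `|eta j t| <= c) ->
  (forall j t, t \notin `]a ord0 j, b ord0 j] -> eta j t = 0) ->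
  forall x, `|tensor eta x| <= c ^+ n * \1_(box a b) x.
Proof.
move=> ec e0 x; rewrite indicE; have [xab|xab] := pselect (box a b x).
  rewrite mem_set// mulr1 normr_prod -[n in leRHS]card_ord -prodr_const.
  by apply: ler_prod => i _; rewrite normr_ge0 ec.
rewrite memNset// mulr0; move: xab; apply: contra_notT; rewrite -ltNge => tx j.
move: tx; apply: contraLR => xj.
by rewrite -leNgt /tensor (bigD1 j)//= e0// mul0r normr0.
Qed.

End tensor.

(** * Smooth approximations of jumps and of the positive part *)

Section approximation.
Context {R : realType}.
Implicit Types (f : R -> R) (a b s t : R).

Lemma smooth1_affine f a b : smooth1 f -> smooth1 (fun t => f (a * t + b)).
Proof. by move=> sf n; exact: Cn_affine. Qed.

Lemma smooth1D f g : smooth1 f -> smooth1 g -> smooth1 (fun t => f t + g t).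
Proof. by move=> sf sg n; exact: CnD. Qed.

Lemma smooth1Z f a : smooth1 f -> smooth1 (fun t => a * f t).
Proof. by move=> sf n; apply: CnM => //; exact: Cn_cst. Qed.

(** With the Heaviside function for f this is the indicator of ]a, b]; differences
    with step b - a also commute with differentiation, which is why indicators are
    built in this way. *)
Definition jump f a b t : R := f (t - a) - f (t - b).

Definition dilate f (k : nat) t : R := f (k.+1%:R * t).

Lemma smooth1_dilate f k : smooth1 f -> smooth1 (dilate f k).
Proof.
move=> sf; have := smooth1_affine k.+1%:R 0 sf.
by under [X in smooth1 X -> _]eq_fun do rewrite addr0.
Qed.

Lemma smooth1_jump f a b : smooth1 f -> smooth1 (jump f a b).
Proof.
move=> sf; have -> : jump f a b = (fun t => f (1 * t + - a) + -1 * f (1 * t + - b)).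
  by apply/funext => t; rewrite /jump !mul1r mulN1r.
by apply: smooth1D; [|apply: smooth1Z]; exact: smooth1_affine.
Qed.

Lemma derive1_jump f a b : smooth1 f -> derive1 (jump f a b) = jump (derive1 f) a b.
Proof.
move=> sf; apply/funext => t; rewrite derive1E.
have d c : is_derive t (1 : R) (fun y => f (y - c)) (derive1 f (t - c)).
  have df := smooth1_is_derive sf (t - c).
  have dc : is_derive t (1 : R) (fun y : R => y - c) 1.
    by apply: is_derive_eq; rewrite subr0.
  have := @is_derive1_comp _ f (fun y => y - c) t _ _ df dc.
  by rewrite mulr1.
have := is_deriveB (d a) (d b).
by move/@derive_val.
Qed.

Lemma derive1_dilate f k : smooth1 f ->
  derive1 (dilate f k) = fun t => k.+1%:R * dilate (derive1 f) k t.
Proof.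
move=> sf; apply/funext => t; rewrite derive1E.
have df := smooth1_is_derive sf (k.+1%:R * t).
have dc : is_derive t (1 : R) (fun y : R => k.+1%:R * y) k.+1%:R.
  by apply: is_derive_eq; rewrite /GRing.scale /= mulr1.
have := @is_derive1_comp _ f (fun y => k.+1%:R * y) t _ _ df dc.
by move/@derive_val => ->; rewrite mulrC.
Qed.

Lemma cvg_jump (f_ : nat -> R -> R) f a b t :
  (forall t, f_ k t @[k --> \oo] --> f t) ->
  jump (f_ k) a b t @[k --> \oo] --> jump f a b t.
Proof. by move=> ff; apply: cvgB; exact: ff. Qed.

(** The value 0 at the origin makes jumps indicators of intervals open on the
    left, in agreement with boxes, and is the value of [step] and of the derivative
    of [ramp] there: the approximations converge at every point. *)
Definition heaviside t : R := (0 < t)%R%:R.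

Lemma near_dilate t : 0 < t -> \forall k \near \oo, 1 < k.+1%:R * t.
Proof.
move=> t0; near=> k; rewrite -ltr_pdivrMr// mul1r.
apply: (@lt_le_trans _ _ k%:R); last by rewrite ler_nat.
by near: k; exact: nbhs_infty_gtr.
Unshelve. all: by end_near. Qed.

Lemma cvg_dilate f t : (forall t, t <= 0 -> f t = 0) -> (forall t, 1 < t -> f t = 1) ->
  dilate f k t @[k --> \oo] --> heaviside t.
Proof.
move=> f0 f1; rewrite /heaviside /dilate; have [t0|t0] := ltP 0 t.
  apply: cvg_near_cst; near=> k; rewrite f1//.
  by near: k; exact: near_dilate.
apply: cvg_near_cst; near=> k; rewrite f0//.
by rewrite mulr_ge0_le0.
Unshelve. all: by end_near. Qed.

Lemma cvg_dilate_step t : dilate step k t @[k --> \oo] --> heaviside t.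
Proof. by apply: cvg_dilate => y; [exact: step_le0|move/ltW; exact: step_ge1]. Qed.

Lemma cvg_dilate_ramp' t : dilate (derive1 ramp) k t @[k --> \oo] --> heaviside t.
Proof.
by apply: cvg_dilate => y; [exact: derive_ramp_le0|exact: derive_ramp_gt1].
Qed.

Definition pospart t : R := Num.max t 0.

(** The prefactor compensates the dilation, so that the derivatives are the
    dilations of the derivative of [ramp]. *)
Definition small_ramp k t : R := k.+1%:R^-1 * dilate ramp k t.

Lemma cvg_small_ramp t : small_ramp k t @[k --> \oo] --> pospart t.
Proof.
rewrite /pospart /small_ramp /dilate; case: (leP t 0) => t0.
  by apply: cvg_near_cst; near=> k; rewrite ramp_le0 ?mulr0// mulr_ge0_le0.
apply: cvg_near_cst; near=> k; rewrite ramp_ge1 ?mulKf// ltW//.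
by near: k; exact: near_dilate.
Unshelve. all: by end_near. Qed.

Lemma smooth1_small_ramp k : smooth1 (small_ramp k).
Proof. by apply: smooth1Z; apply: smooth1_dilate; exact: smooth1_ramp. Qed.

Lemma derive1_small_ramp k : derive1 (small_ramp k) = dilate (derive1 ramp) k.
Proof.
have sr := smooth1_dilate k (@smooth1_ramp R).
apply/funext => t; rewrite derive1E.
have := @is_deriveZ _ _ _ _ (k.+1%:R^-1) _ _ _ (smooth1_is_derive sr t).
move/@derive_val => ->; rewrite derive1_dilate; last exact: smooth1_ramp.
by rewrite /GRing.scale /= mulKf.
Qed.

Lemma small_ramp_bound k t : `|small_ramp k t| <= pospart t.
Proof.
rewrite /small_ramp /pospart /dilate; case: (leP t 0) => t0.
  by rewrite ramp_le0 ?mulr0 ?normr0// mulr_ge0_le0.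
rewrite /ramp mulrA mulKf// normrM (ger0_norm (ltW t0)).
by rewrite ger0_norm ?step_ge0// ler_piMr ?step_le1// ltW.
Qed.

Lemma jump_le f a b t : a <= b -> (forall y, y <= 0 -> f y = 0) -> t <= a -> jump f a b t = 0.
Proof. by move=> ab f0 ta; rewrite /jump !f0 ?subrr//; lra. Qed.

Lemma dilate_le0 f k t : (forall y, y <= 0 -> f y = 0) -> t <= 0 -> dilate f k t = 0.
Proof. by move=> f0 t0; rewrite /dilate f0// mulr_ge0_le0. Qed.

Lemma dilate_gt1 f k t c : (forall y, 1 < y -> f y = c) -> 1 < t -> dilate f k t = c.
Proof.
move=> f1 t1; rewrite /dilate f1//.
by rewrite (lt_le_trans t1)// ler_peMl ?ler1n//; lra.
Qed.

Lemma small_ramp_gt1 k t : 1 < t -> small_ramp k t = t.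
Proof.
move=> t1; rewrite /small_ramp /dilate ramp_ge1 ?mulKf//.
by rewrite ltW// (lt_le_trans t1)// ler_peMl ?ler1n//; lra.
Qed.

Lemma jump_heaviside a b t : a <= b -> jump heaviside a b t = \1_(`]a, b]%classic) t.
Proof.
move=> ab; rewrite /jump /heaviside indicE mem_setE !subr_gt0 in_itv/=.
have [bt|tb] := ltP b t; first by rewrite (le_lt_trans ab bt) andbF subrr.
by rewrite andbT subr0.
Qed.

End approximation.

(** * Weak derivatives and limits of products *)

Section weak_derivative_box.
Context {R : realType} {n : nat}.
Local Notation T := 'rV[R]_n.
Local Notation mu := (lebesgue_rV n : {sigma_finite_measure set T -> \bar R}).
Implicit Types (u w : T -> R).

Definition square_integrable u : Prop :=
  measurable_fun setT u /\ (\int[mu]_x (u x ^+ 2)%:E < +oo)%E.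

Definition real_weak_partial (i : 'I_n) u w : Prop :=
  forall phi, test_function phi ->
    \int[mu]_x (u x * partial i phi x) = - \int[mu]_x (w x * phi x).

Lemma measurable_indic_box (a b : T) : measurable_fun setT (\1_(box a b) : T -> R).
Proof. by apply: measurable_indic; exact: measurable_box. Qed.

Lemma lebesgue_box_lty (a b : T) : (mu (box a b) < +oo)%E.
Proof.
apply: (@le_lt_trans _ _ (mu (box a (\row_i (Num.max (a ord0 i) (b ord0 i)))))).
  apply: le_measure; rewrite ?inE; try exact: measurable_box.
  move=> x Bx i; have := Bx i; rewrite !in_itv/= mxE => /andP[-> h].
  by rewrite le_max h orbT.
by rewrite lebesgue_box ?ltry// => i; rewrite mxE le_max lexx.
Qed.

(** The measure of a box is finite and |u| <= 1 + u^2. *)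
Lemma integrable_box u (a b : T) : square_integrable u ->
  mu.-integrable setT (fun x => (`|u x| * \1_(box a b) x)%:E).
Proof.
move=> [mu_ iu].
have i1 : mu.-integrable setT (fun x => (u x ^+ 2)%:E).
  apply/integrableP; split; first by apply/measurable_EFinP; exact: measurable_funX.
  by under eq_integral do rewrite gee0_abs ?lee_fin ?sqr_ge0//.
have i2 : mu.-integrable setT (fun x => (\1_(box a b) x : R)%:E).
  apply/integrableP; split; first by apply/measurable_EFinP; exact: measurable_indic_box.
  under eq_integral do rewrite gee0_abs ?lee_fin//.
  rewrite integral_indic//; last exact: measurable_box.
  by rewrite setIT; exact: lebesgue_box_lty.
apply: le_integrable (integrableD measurableT i1 i2) => //.
  apply/measurable_EFinP; apply: measurable_funM; last exact: measurable_indic_box.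
  exact: measurableT_comp.
move=> x _; rewrite -EFinD !abse_EFin lee_fin normrM normr_id.
rewrite [leRHS]ger0_norm; last by rewrite addr_ge0 ?sqr_ge0// indicE.
rewrite indicE; case: (x \in _); rewrite /= ?normr1 ?normr0 ?mulr1 ?mulr0; last by rewrite addr0 sqr_ge0.
rewrite -real_normK ?num_real//.
by have := normr_ge0 (u x); set y := `|u x|; nra.
Qed.

Lemma measurable_tensor (eta : 'I_n -> R -> R) :
  (forall j, measurable_fun setT (eta j)) -> measurable_fun setT (tensor eta).
Proof.
move=> me; rewrite /tensor; elim: (index_enum _) => [|i r IH].
  under eq_fun do rewrite big_nil.
  exact: measurable_cst.
under eq_fun do rewrite big_cons.
apply: measurable_funM => //.
by apply: (measurableT_comp (me i)); exact: measurable_coord.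
Qed.

Lemma cvg_tensor (eta_ : nat -> 'I_n -> R -> R) (eta : 'I_n -> R -> R) (x : T) :
  (forall j t, eta_ k j t @[k --> \oo] --> eta j t) ->
  tensor (eta_ k) x @[k --> \oo] --> tensor eta x.
Proof.
move=> ce; rewrite /tensor; elim: (index_enum _) => [|i r IH].
  rewrite big_nil; under eq_fun do rewrite big_nil.
  exact: cvg_cst.
rewrite big_cons; under eq_fun do rewrite big_cons.
by apply: cvgM => //; exact: ce.
Qed.

(** Dominated convergence: uniformly bounded factors supported in a common box are
    dominated by a multiple of |u| on this box, which is integrable. *)
Lemma Rintegral_tensor_cvg u (eta_ : nat -> 'I_n -> R -> R) (eta : 'I_n -> R -> R)
    (c : R) (a b : T) :
  square_integrable u ->
  (forall k j, continuous (eta_ k j)) ->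
  (forall j t, eta_ k j t @[k --> \oo] --> eta j t) ->
  (forall k j t, `|eta_ k j t| <= c) ->
  (forall k j t, t \notin `]a ord0 j, b ord0 j] -> eta_ k j t = 0) ->
  \int[mu]_x (u x * tensor (eta_ k) x) @[k --> \oo] --> \int[mu]_x (u x * tensor eta x).
Proof.
move=> su cont ce bd sp; have [mu_ _] := su.
have mt k : measurable_fun setT (fun x => (u x * tensor (eta_ k) x)%:E).
  apply/measurable_EFinP; apply: measurable_funM => //; apply: measurable_tensor => j.
  exact: continuous_measurable_fun.
have cv x : (u x * tensor (eta_ k) x)%:E @[k --> \oo] --> (u x * tensor eta x)%:E.
  apply: cvg_EFin; first by apply: nearW => k.
  by apply: cvgM; [exact: cvg_cst|exact: cvg_tensor].
have ig := integrable_box a b su.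
have ig2 := integrableZl measurableT (c ^+ n) ig.
have [] := @dominated_convergence _ _ _ mu setT measurableT
    (fun k x => (u x * tensor (eta_ k) x)%:E) (fun x => (u x * tensor eta x)%:E) _
    mt _ _ ig2 _.
- by apply: (emeasurable_fun_cvg _ _ mt) => x _; exact: cv.
- by apply: aeW => x _; exact: cv.
- apply: aeW => x k _; rewrite abse_EFin -EFinM lee_fin normrM mulrCA.
  apply: ler_wpM2l => //; apply: tensor_box => [j t|j t].
    exact: bd.
  exact: sp.
move=> ilim _ cint; apply: fine_cvg; rewrite fineK//.
by apply: integrable_fin_num.
Qed.

End weak_derivative_box.

(** * The weak derivative tested on a box in motion *)

Section swept_box.
Context {R : realType} {n : nat}.
Local Notation T := 'rV[R]_n.
Local Notation mu := (lebesgue_rV n : {sigma_finite_measure set T -> \bar R}).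
Implicit Types (u w : T -> R).

Lemma jump_support (f : R -> R) (B a b c t : R) : (forall y, y <= 0 -> f y = 0) ->
  (forall y, 1 < y -> f y = B) -> a <= b -> b + 1 <= c ->
  t \notin `]a, c] -> jump f a b t = 0.
Proof.
move=> f0 f1 ab bc; rewrite in_itv/= negb_and -leNgt -ltNge => /orP[ta|ct].
  exact: jump_le.
by rewrite /jump !f1 ?subrr//; lra.
Qed.

(** A second difference kills affine functions, so the double jump vanishes to the
    right of both as well. *)
Lemma jump2_support (f : R -> R) (A B a b c s t : R) : (forall y, y <= 0 -> f y = 0) ->
  (forall y, 1 < y -> f y = A * y + B) -> a <= b -> 0 <= s -> b + s + 1 <= c ->
  t \notin `]a, c] -> jump (jump f a b) 0 s t = 0.
Proof.
move=> f0 f1 ab s0 bc; rewrite in_itv/= negb_and -leNgt -ltNge => /orP[ta|ct].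
  by rewrite /jump !f0 ?subrr//; lra.
by rewrite /jump !f1; [ring|lra..].
Qed.

Lemma jump2_bound (f : R -> R) (K a b s t : R) : a <= b -> 0 <= s ->
  (forall y, y <= t - a -> `|f y| <= K) -> `|jump (jump f a b) 0 s t| <= 4 * K.
Proof.
move=> ab s0 fK; rewrite /jump !subr0.
have h y : y <= t - a -> - K <= f y <= K by rewrite -ler_norml; exact: fK.
have /andP[h1 h2] := h (t - a) (lexx _).
have /andP[h3 h4] : - K <= f (t - b) <= K by apply: h; lra.
have /andP[h5 h6] : - K <= f (t - s - a) <= K by apply: h; lra.
have /andP[h7 h8] : - K <= f (t - s - b) <= K by apply: h; lra.
by rewrite ler_norml; apply/andP; split; lra.
Qed.

Section approximate_box.
Variables (a b : T) (s : R) (i : 'I_n).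
Hypotheses (ab : forall j, a ord0 j <= b ord0 j) (s0 : 0 <= s).

Definition smooth_sweep (k : nat) (j : 'I_n) : R -> R :=
  if j == i then jump (jump (small_ramp k) (a ord0 j) (b ord0 j)) 0 s
  else jump (dilate step k) (a ord0 j) (b ord0 j).

(** The product of these factors at x is the time that x spends in the box while
    the box is moved by s in the direction e_i: the second difference of the
    positive part is this time for the coordinate i, and the other coordinates
    contribute an indicator. *)
Definition sweep (j : 'I_n) : R -> R :=
  if j == i then jump (jump pospart (a ord0 j) (b ord0 j)) 0 s
  else jump heaviside (a ord0 j) (b ord0 j).

(** The derivative of [sweep] in direction e_i: the indicator of the box minus
    that of the box in its final position. *)
Definition shift_difference (j : 'I_n) : R -> R :=
  if j == i then jump (jump heaviside (a ord0 j) (b ord0 j)) 0 s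
  else jump heaviside (a ord0 j) (b ord0 j).

Lemma smooth1_smooth_sweep k j : smooth1 (smooth_sweep k j).
Proof.
rewrite /smooth_sweep; case: ifP => _.
  by do 2!apply: smooth1_jump; exact: smooth1_small_ramp.
by apply: smooth1_jump; apply: smooth1_dilate; exact: smooth1_step.
Qed.

Lemma dtensor_smooth_sweep k : dtensor (smooth_sweep k) i = fun j =>
  if j == i then jump (jump (dilate (derive1 ramp) k) (a ord0 j) (b ord0 j)) 0 s
  else jump (dilate step k) (a ord0 j) (b ord0 j).
Proof.
apply/funext => j; rewrite /dtensor /smooth_sweep; case: (j == i) => //.
have sr := @smooth1_small_ramp R k.
rewrite derive1_jump; last exact: smooth1_jump.
by rewrite derive1_jump// derive1_small_ramp.
Qed.

(* All approximations live in the box from a to c: they have settled to their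
   limit at distance 1 from a jump, and the last jump is at b + s. *)
Let c : T := \row_j (b ord0 j + s + 1).

Let step_support k j t : t \notin `]a ord0 j, c ord0 j] ->
  jump (dilate step k) (a ord0 j) (b ord0 j) t = 0.
Proof.
have s0' := s0; rewrite mxE; apply: (@jump_support _ 1) => //; last lra.
  by move=> y; apply: dilate_le0; exact: step_le0.
by move=> y; apply: dilate_gt1 => z /ltW; exact: step_ge1.
Qed.

Let step_bound k j t : `|jump (dilate step k) (a ord0 j) (b ord0 j) t| <= 1.
Proof.
have h (y : R) : 0 <= dilate step k y <= 1 by rewrite step_ge0 step_le1.
rewrite /jump ler_norml.
have /andP[h1 h2] := h (t - a ord0 j); have /andP[h3 h4] := h (t - b ord0 j).
by apply/andP; split; lra.
Qed.

Let sweep_support k j t : t \notin `]a ord0 j, c ord0 j] -> smooth_sweep k j t = 0.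
Proof.
have s0' := s0; move=> tac; rewrite /smooth_sweep; case: ifP => _; last exact: step_support.
apply: (@jump2_support _ 1 0 _ _ _ _ _ _ _ _ _ _ tac); rewrite ?mxE//.
  by move=> y y0; rewrite /small_ramp dilate_le0 ?mulr0//; exact: ramp_le0.
by move=> y y1; rewrite small_ramp_gt1// mul1r addr0.
Qed.

(** The swept time is a Lipschitz function, not a test function; its smooth
    approximations are test functions, and both sides of the definition of a weak
    derivative pass to the limit by dominated convergence. *)
Lemma weak_partial_sweep u w : square_integrable u -> square_integrable w ->
  real_weak_partial i u w ->
  \int[mu]_x (u x * tensor shift_difference x) = - \int[mu]_x (w x * tensor sweep x).
Proof.
move=> su sw wuw.
have s0' := s0.
have dr0 k (y : R) : y <= 0 -> dilate (derive1 ramp) k y = 0.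
  by apply: dilate_le0; exact: derive_ramp_le0.
have dr1 k (y : R) : 1 < y -> dilate (derive1 ramp) k y = 0 * y + 1.
  by rewrite mul0r add0r; apply: dilate_gt1; exact: derive_ramp_gt1.
have [K K0 rK] := @derive_ramp_bounded R.
(* The derivatives of the approximations converge to the difference of indicators. *)
have cvD : \int[mu]_x (u x * tensor (dtensor (smooth_sweep k) i) x) @[k --> \oo] -->
    \int[mu]_x (u x * tensor shift_difference x).
  apply: (@Rintegral_tensor_cvg _ _ _ _ _ (1 + 4 * K) a c) => //.
  - move=> k j; apply: smooth1_continuous; apply: smooth1_dtensor => l.
    exact: smooth1_smooth_sweep.
  - move=> j t; under eq_fun do rewrite dtensor_smooth_sweep.
    rewrite /shift_difference; case: ifP => _; last first.
      by apply: cvg_jump; exact: cvg_dilate_step.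
    by do 2!apply: cvg_jump => ?; exact: cvg_dilate_ramp'.
  - move=> k j t; rewrite dtensor_smooth_sweep; case: ifP => _; last first.
      by apply: (le_trans (step_bound _ _ _)); lra.
    apply: (@le_trans _ _ (4 * K)); last by lra.
    by apply: jump2_bound => // y _; exact: rK.
  - move=> k j t tac; rewrite dtensor_smooth_sweep; case: ifP => _; last exact: step_support.
    by apply: (@jump2_support _ 0 1 _ _ _ _ _ (dr0 k) (dr1 k) _ _ _ tac); rewrite ?mxE.
(* The bound is the total width of the enclosing box, summed over the directions
   to be independent of the direction. *)
have cvS : \int[mu]_x (w x * tensor (smooth_sweep k) x) @[k --> \oo] -->
    \int[mu]_x (w x * tensor sweep x).
  apply: (@Rintegral_tensor_cvg _ _ _ _ _
     (1 + \sum_j 4 * (b ord0 j + s + 1 - a ord0 j)) a c) => //.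
  - move=> k j; apply: smooth1_continuous; exact: smooth1_smooth_sweep.
  - move=> j t; rewrite /smooth_sweep /sweep; case: ifP => _; last first.
      by apply: cvg_jump; exact: cvg_dilate_step.
    by do 2!apply: cvg_jump => ?; exact: cvg_small_ramp.
  - have L0 j : 0 <= 4 * (b ord0 j + s + 1 - a ord0 j) by have := ab j; lra.
    have S0 : 0 <= \sum_j 4 * (b ord0 j + s + 1 - a ord0 j) by exact: sumr_ge0.
    move=> k j t; have [tac|tac] := boolP (t \in `]a ord0 j, c ord0 j]); last first.
      by rewrite sweep_support// normr0 addr_ge0.
    rewrite /smooth_sweep; case: ifP => _; last first.
      by apply: (le_trans (step_bound _ _ _)); rewrite lerDl.
    apply: (@le_trans _ _ (4 * (b ord0 j + s + 1 - a ord0 j))).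
      move: tac; rewrite in_itv/= mxE => /andP[at_ tc].
      apply: jump2_bound => // y yt; apply: (le_trans (small_ramp_bound k y)).
      by rewrite /pospart ge_max; apply/andP; split; have := ab j; lra.
    by rewrite (bigD1 j)//= ler_wpDl// lerDl sumr_ge0.
have test k : test_function (tensor (smooth_sweep k)).
  apply: (@test_function_tensor _ _ _ a c) => [j|j t].
    exact: smooth1_smooth_sweep.
  exact: sweep_support.
have eqk k : \int[mu]_x (u x * tensor (dtensor (smooth_sweep k) i) x) =
    - \int[mu]_x (w x * tensor (smooth_sweep k) x).
  rewrite -wuw// partial_tensor// => j; exact: smooth1_smooth_sweep.
move: cvD; under eq_fun do rewrite eqk.
move=> cvD; rewrite -(cvg_lim (@Rhausdorff R) cvD); apply: cvg_lim => //.
exact: cvgN.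
Qed.

End approximate_box.
End swept_box.

(** * Densities are determined by their integrals over boxes *)

Section density.
Context {R : realType} {n : nat}.
Local Notation T := 'rV[R]_n.
Local Notation mu := (lebesgue_rV n : {sigma_finite_measure set T -> \bar R}).
Local Open Scope ereal_scope.

Section density_measure.
Variable f : T -> \bar R.
Hypotheses (mf : measurable_fun setT f) (f0 : forall x, 0 <= f x).

(** The proofs are arguments so that the measure structure can be attached to the
    function. *)
Definition density (mf : measurable_fun setT f) (f0 : forall x, 0 <= f x) (A : set T) : \bar R :=
  \int[mu]_(x in A) f x.

Let density0 : density mf f0 set0 = 0.
Proof. exact: integral_set0. Qed.

Let density_ge0 A : 0 <= density mf f0 A.
Proof. by apply: integral_ge0. Qed.

Let density_semi_sigma_additive : semi_sigma_additive (density mf f0).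
Proof. exact: semi_sigma_additive_nng_induced. Qed.

HB.instance Definition _ := isMeasure.Build _ _ _ (density mf f0)
  density0 density_ge0 density_semi_sigma_additive.

End density_measure.

(** Both densities define measures that agree on boxes and are finite on cubes,
    hence agree on all Borel sets; on each cube this forces equality almost
    everywhere. *)
Lemma density_unique (f g : T -> \bar R) :
  measurable_fun setT f -> measurable_fun setT g ->
  (forall x, 0 <= f x) -> (forall x, 0 <= g x) ->
  (forall a b : T, (forall j, a ord0 j <= b ord0 j)%R ->
     \int[mu]_(x in box a b) f x = \int[mu]_(x in box a b) g x) ->
  (forall k, \int[mu]_(x in cube_of_radius k) f x < +oo) ->
  {ae mu, forall x, f x = g x}.
Proof.
move=> mf mg f0 g0 fg foo.
have fgA A : measurable A -> \int[mu]_(x in A) f x = \int[mu]_(x in A) g x.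
  move=> mA; apply: (@box_measure_unique R n (density mf f0) (density mg g0)) => // a b.
  have [ab|/existsNP[j /negP]] := pselect (forall j, a ord0 j <= b ord0 j)%R.
    exact: fg.
  rewrite -ltNge => ba; rewrite (_ : box a b = set0) ?measure0//.
  apply/seteqP; split => // x /(_ j); rewrite in_itv/= => /andP[h1 h2].
  by have := lt_le_trans h1 h2; rewrite ltNge ltW.
have aek k : ae_eq mu (cube_of_radius k) f g.
  apply: integral_ae_eq; first exact: measurable_box.
  - apply/integrableP; split; first exact: measurable_funTS.
    by under eq_integral do rewrite gee0_abs//.
  - exact: measurable_funTS.
  - by move=> E _ mE; exact: fgA.
have : {ae mu, forall x, forall k, cube_of_radius k x -> f x = g x}.
  by apply: ae_foralln => k; exact: aek.
apply: filterS => x H; have : (\bigcup_k cube_of_radius k) x by rewrite bigcup_cube_of_radius.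
by move=> [k _ /H].
Qed.

End density.

(** * A moving box as a time average *)

Section sweep_integral.
Context {R : realType} {n : nat}.
Local Notation T := 'rV[R]_n.
Local Notation mu := (lebesgue_rV n : {sigma_finite_measure set T -> \bar R}).
Local Notation leb := (@lebesgue_measure R).

(** The set of times tau in [0, s[ with t - tau in ]a, b] is the interval
    [max(0, t - b), min(s, t - a)[, and its length is a second difference of the
    positive part. *)
Lemma integral_indic_translate (a b s t : R) : a <= b -> 0 <= s ->
  (\int[leb]_(tau in `[0%R, s[) (\1_(`]a, b]%classic) (t - tau)%R)%:E =
   (jump (jump pospart a b) 0 s t)%:E)%E.
Proof.
move=> ab s0.
rewrite (eq_integral (fun tau : measurableTypeR R => (\1_(`[t - b, t - a[%classic) tau)%:E)); last first.
  move=> tau _; rewrite !indicE !mem_setE !in_itv/=; congr ((nat_of_bool _)%:R%:E).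
  by apply/andP/andP => -[h1 h2]; split; lra.
rewrite integral_indic//.
have -> : `[t - b, t - a[%classic `&` `[0%R, s[%classic =
    `[Num.max 0 (t - b), Num.min s (t - a)[%classic.
  apply/seteqP; split=> x /=; rewrite !in_itv/= ge_max lt_min.
    by move=> [/andP[-> ->] /andP[-> ->]].
  by move=> /andP[/andP[-> ->] /andP[-> ->]].
rewrite [LHS](lebesgue_measure_itv `[Num.max 0 (t - b), Num.min s (t - a)[) /= lte_fin.
rewrite [LHS](_ : _ = (Num.max 0 (Num.min s (t - a) - Num.max 0 (t - b)))%:E); last first.
  rewrite -EFinB; set p := Num.max 0 (t - b); set q := Num.min s (t - a).
  by have [h|h] := ltP p q; congr EFin; case: (leP 0 (q - p)) => //; lra.
congr EFin; rewrite /jump /pospart !subr0.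
have -> : Num.max (t - s - a) 0 = t - a - Num.min s (t - a).
  by have [h|h] := leP s (t - a); have [h'|h'] := leP (t - s - a) 0; lra.
have [h1|h1] := leP s (t - a); have [h2|h2] := leP 0 (t - b);
  have [h3|h3] := leP (t - s - b) 0; have [h4|h4] := leP (t - a) 0;
  have [h5|h5] := leP 0 (_ - _); lra.
Qed.

Section one_box.
Variables (a b : T) (i : 'I_n) (s : R).
Hypotheses (ab : forall j, a ord0 j <= b ord0 j) (s0 : 0 <= s).
Local Notation e := (delta_mx ord0 i : T).

Lemma indic_box_line (tau : R) (x : T) :
  \1_(box a b) (x - tau *: e) = (\prod_(j | j != i) jump heaviside (a ord0 j) (b ord0 j) (x ord0 j)) *
    \1_(`]a ord0 i, b ord0 i]%classic) (x ord0 i - tau) :> R.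
Proof.
have -> : \1_(box a b) (x - tau *: e) =
    \prod_j \1_(`]a ord0 j, b ord0 j]%classic) ((x - tau *: e) ord0 j) :> R.
  rewrite indicE; have [xab|] := pselect (box a b (x - tau *: e)).
    rewrite mem_set// big1// => j _.
    by rewrite indicE mem_set//; exact: xab.
  move=> xab; rewrite memNset//; move: xab => /existsNP[j /negP xj].
  by rewrite (bigD1 j)//= indicE mem_setE (negPf xj) mul0r.
rewrite (bigD1 i)//= mulrC; congr (_ * _).
  apply: eq_bigr => j ji; rewrite jump_heaviside// !mxE eqxx (negPf ji).
  by rewrite mulr0 subr0.
by rewrite !mxE !eqxx mulr1.
Qed.

Lemma tensor_sweepE x : tensor (sweep a b s i) x =
  (\prod_(j | j != i) jump heaviside (a ord0 j) (b ord0 j) (x ord0 j)) *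
    jump (jump pospart (a ord0 i) (b ord0 i)) 0 s (x ord0 i).
Proof.
rewrite /tensor (bigD1 i)//= mulrC /sweep eqxx; congr (_ * _).
by apply: eq_bigr => j /negPf ->.
Qed.

Lemma tensor_shift_differenceE x : tensor (shift_difference a b s i) x =
  \1_(box a b) x - \1_(box a b) (x - s *: e).
Proof.
rewrite -[x in \1__ x]subr0 -(scale0r e) !indic_box_line -mulrBr.
rewrite /tensor (bigD1 i)//= mulrC /shift_difference eqxx; congr (_ * _).
  by apply: eq_bigr => j /negPf ->.
by rewrite -!jump_heaviside.
Qed.

Lemma measurable_line (c : R) (g : T -> R) : measurable_fun setT g ->
  measurable_fun setT (fun p : T * measurableTypeR R => g (p.1 + (c * p.2) *: e)).
Proof.
move=> mg; apply: (measurableT_comp mg); apply: measurable_fun_rVP => j.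
under eq_fun do rewrite !mxE.
apply: measurable_funD.
  exact: (measurableT_comp (measurable_coord j) measurable_fst).
apply: measurable_funM => //; apply: measurable_funM => //; exact: measurable_snd.
Qed.

(** By Tonelli, integrating the translates of g over the box is integrating g
    against the time spent in the translates of the box. *)
Lemma integral_sweep (g : T -> R) : measurable_fun setT g -> (forall x, 0 <= g x) ->
  (\int[mu]_(x in box a b) \int[leb]_(tau in `[0%R, s[) (g (x + tau *: e)%R)%:E =
   \int[mu]_x (g x * tensor (sweep a b s i) x)%:E)%E.
Proof.
move=> mg g0.
pose I : R -> R := \1_(`[0%R, s[%classic).
have mI : measurable_fun setT (I : measurableTypeR R -> R) by exact: measurable_indic.
have I0 tau : 0 <= I tau by rewrite /I indicE.
have B0 x : 0 <= \1_(box a b) x :> R by rewrite indicE.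
pose f (p : T * measurableTypeR R) : \bar R :=
  (\1_(box a b) p.1 * (I p.2 * g (p.1 + p.2 *: e)))%:E.
transitivity (\int[mu]_x \int[leb]_tau f (x, tau))%E.
  rewrite [LHS]integral_mkcond; apply: eq_integral => x _.
  rewrite patchE /f /= indicE; case: ifPn => xab; last first.
    by under eq_integral do rewrite mul0r; rewrite integral0.
  under [RHS]eq_integral do rewrite mul1r.
  rewrite [LHS]integral_mkcond; apply: eq_integral => tau _.
  by rewrite patchE /I indicE; case: ifPn => _; rewrite ?mul1r ?mul0r.
have mf : measurable_fun setT f.
  apply/measurable_EFinP; apply: measurable_funM.
    by apply: (measurableT_comp _ measurable_fst); exact: measurable_indic_box.
  apply: measurable_funM; first exact: (measurableT_comp mI measurable_snd).
  have := measurable_line 1 mg.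
  by under eq_fun do rewrite mul1r.
have f0 p : (0 <= f p)%E by rewrite lee_fin !mulr_ge0.
rewrite (@fubini_tonelli _ _ _ _ _ mu leb f mf f0).
(* After exchange of the integrals, x + tau e is renamed x: the translation moves
   from g to the indicator of the box. *)
pose f' (p : T * measurableTypeR R) : \bar R :=
  (\1_(box a b) (p.1 - p.2 *: e) * (I p.2 * g p.1))%:E.
have mf' : measurable_fun setT f'.
  apply/measurable_EFinP; apply: measurable_funM.
    have := measurable_line (-1) (measurable_indic_box a b).
    by under eq_fun do rewrite mulN1r scaleNr.
  apply: measurable_funM; first exact: (measurableT_comp mI measurable_snd).
  exact: (measurableT_comp mg measurable_fst).
have f'0 p : (0 <= f' p)%E by rewrite lee_fin !mulr_ge0.
transitivity (\int[leb]_tau \int[mu]_x f' (x, tau))%E.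
  apply: eq_integral => tau _.
  rewrite -[RHS](integral_shift (tau *: e)) //.
  - by apply: eq_integral => x _; rewrite /f /f' /= addrK.
  - exact: (measurableT_comp mf' (measurable_pair2 _)).
rewrite -(@fubini_tonelli _ _ _ _ _ mu leb f' mf' f'0).
apply: eq_integral => x _; rewrite /f' /=.
pose C := \prod_(j | j != i) jump heaviside (a ord0 j) (b ord0 j) (x ord0 j) : R.
have C0 : 0 <= C by apply: prodr_ge0 => j _; rewrite jump_heaviside// indicE.
transitivity (\int[leb]_(tau in `[0%R, s[) ((g x * C)%:E * (\1_(`]a ord0 i, b ord0 i]%classic) (x ord0 i - tau)%R)%:E))%E.
  rewrite [RHS]integral_mkcond; apply: eq_integral => tau _.
  rewrite patchE indic_box_line -/C; have -> : I tau = (tau \in `[0%R, s[%classic)%:R by rewrite /I indicE.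
  case: ifPn => _; last by rewrite mul0r mulr0.
  by rewrite -EFinM mul1r; congr EFin; ring.
rewrite ge0_integralZl_EFin//; last 2 first.
- apply/measurable_EFinP; apply: measurable_funTS.
  apply: (@measurableT_comp _ _ _ _ _ _ (\1_(`]a ord0 i, b ord0 i]%classic) : R -> R)) => //.
  by apply: measurable_funB.
- by rewrite mulr_ge0.
rewrite integral_indic_translate// tensor_sweepE -EFinM; congr EFin.
by rewrite -/C mulrA.
Qed.

End one_box.
End sweep_integral.

(** * Integrals along a coordinate direction *)

Section line_integral.
Context {R : realType} {n : nat}.
Local Notation T := 'rV[R]_n.
Local Notation mu := (lebesgue_rV n : {sigma_finite_measure set T -> \bar R}).
Local Notation leb := (@lebesgue_measure R).
Variables (i : 'I_n) (s : R).
Hypothesis s0 : 0 <= s.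
Local Notation e := (delta_mx ord0 i : T).
Implicit Types (g p q r u w : T -> R) (a b : T).

Definition line_integral g (x : T) : \bar R :=
  (\int[leb]_(tau in `[0%R, s[) (g (x + tau *: e)%R)%:E)%E.

Let weighted g (p : T * measurableTypeR R) : \bar R :=
  (\1_(`[0, s[%classic) p.2 * g (p.1 + p.2 *: e))%:E.

Lemma line_integralE g x : line_integral g x = (\int[leb]_tau weighted g (x, tau))%E.
Proof.
rewrite /line_integral integral_mkcond; apply: eq_integral => tau _.
rewrite patchE /weighted /= indicE.
by case: ifPn => _; rewrite ?mul1r ?mul0r.
Qed.

Let measurable_weighted g : measurable_fun setT g -> measurable_fun setT (weighted g).
Proof.
move=> mg; apply/measurable_EFinP; apply: measurable_funM.
  apply: (measurableT_comp _ measurable_snd).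
  exact: (@measurable_indic _ (measurableTypeR R)).
by have := measurable_line i 1 mg; under eq_fun do rewrite mul1r.
Qed.

Lemma line_integral_ge0 g x : (forall y, 0 <= g y) -> (0 <= line_integral g x)%E.
Proof. by move=> g0; apply: integral_ge0 => tau _; rewrite lee_fin. Qed.

Lemma measurable_line_integral g : measurable_fun setT g -> (forall y, 0 <= g y) ->
  measurable_fun setT (line_integral g).
Proof.
move=> mg g0; have -> : line_integral g = fubini_F leb (weighted g).
  by apply/funext => x; rewrite line_integralE.
apply: measurable_fun_fubini_tonelli_F; first exact: measurable_weighted.
by move=> y; rewrite lee_fin mulr_ge0// indicE.
Qed.

(** By Tonelli, since each translate of g has the integral of g. *)
Lemma integral_line_integral g : measurable_fun setT g -> (forall y, 0 <= g y) ->
  (\int[mu]_x line_integral g x = s%:E * \int[mu]_x (g x)%:E)%E.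
Proof.
move=> mg g0; under eq_integral do rewrite line_integralE.
have w0 z : (0 <= weighted g z)%E by rewrite lee_fin mulr_ge0// indicE.
rewrite (@fubini_tonelli _ _ _ _ _ mu leb _ (measurable_weighted mg) w0).
transitivity (\int[leb]_(tau in `[0%R, s[) (cst (\int[mu]_x (g x)%:E) tau))%E.
  rewrite [RHS]integral_mkcond; apply: eq_integral => tau _.
  rewrite patchE /weighted /= indicE; case: ifPn => _ /=.
    under eq_integral do rewrite mul1r.
    apply: (integral_shift (tau *: e) (f := EFin \o g)) => //.
    exact/measurable_EFinP.
  by under eq_integral do rewrite mul0r; rewrite integral0.
rewrite integral_cst// muleC; congr (_ * _)%E.
rewrite [LHS](lebesgue_measure_itv `[0%R, s[)/= lte_fin.
by move: s0; rewrite le_eqVlt => /predU1P[<-|->]; rewrite ?ltxx// oppr0 adde0.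
Qed.

Lemma sweep_bound a b j t : a ord0 j <= b ord0 j -> `|sweep a b s i j t| <= 1 + s.
Proof.
move=> ab; rewrite /sweep; have s0' := s0; case: ifP => _.
  rewrite /jump /pospart !subr0; set A := a ord0 j in ab *; set B := b ord0 j in ab *.
  have [h1|h1] := leP (t - A) 0; have [h2|h2] := leP (t - B) 0;
  have [h3|h3] := leP (t - s - A) 0; have [h4|h4] := leP (t - s - B) 0;
  rewrite ler_norml; apply/andP; split; lra.
rewrite jump_heaviside// indicE; case: (_ \in _); rewrite ?normr1 ?normr0; lra.
Qed.

Lemma sweep_support a b (c : T) j t : a ord0 j <= b ord0 j -> b ord0 j + s <= c ord0 j ->
  t \notin `]a ord0 j, c ord0 j] -> sweep a b s i j t = 0.
Proof.
move=> ab bc; rewrite in_itv/= negb_and -leNgt -ltNge => tac.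
have s0' := s0; rewrite /sweep; case: ifP => _.
  rewrite /jump /pospart !subr0; move: tac.
  set A := a ord0 j in ab *; set B := b ord0 j in ab bc *; set C := c ord0 j in bc *.
  have [h1|h1] := leP (t - A) 0; have [h2|h2] := leP (t - B) 0;
  have [h3|h3] := leP (t - s - A) 0; have [h4|h4] := leP (t - s - B) 0;
  case/orP => h; lra.
rewrite jump_heaviside// indicE mem_setE in_itv/=; case/orP: tac => h.
  by rewrite ltNge h.
by rewrite andbC leNgt (_ : b ord0 j < t)//; lra.
Qed.

Lemma integrable_indic_box u a b : square_integrable u ->
  mu.-integrable setT (fun x => (u x * \1_(box a b) x)%:E).
Proof.
move=> su; have [mu_ _] := su; apply: le_integrable (integrable_box a b su) => //.
  by apply/measurable_EFinP; apply: measurable_funM => //; exact: measurable_indic_box.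
by move=> x _; rewrite !abse_EFin !normrM normr_id.
Qed.

Lemma integrable_indic_box_shift u a b (h : T) : square_integrable u ->
  mu.-integrable setT (fun x => (u x * \1_(box a b) (x - h))%:E).
Proof.
have -> : (fun x => (u x * \1_(box a b) (x - h))%:E) =
    (fun x => (u x * \1_(box (a + h) (b + h)) x)%:E).
  apply/funext => x; rewrite !indicE; congr (_ * (nat_of_bool _)%:R)%:E.
  by apply/idP/idP => /set_mem xab; apply/mem_set => j; have := xab j;
    rewrite !in_itv/= !mxE => /andP[h1 h2]; apply/andP; split; lra.
exact: integrable_indic_box.
Qed.

Lemma integrable_sweep u a b : (forall j, a ord0 j <= b ord0 j) -> square_integrable u ->
  mu.-integrable setT (fun x => (u x * tensor (sweep a b s i) x)%:E).
Proof.
move=> ab su; have [mu_ _] := su.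
pose c : T := \row_j (b ord0 j + s).
have ig := integrableZl measurableT ((1 + s) ^+ n) (integrable_box a c su).
apply: le_integrable ig => //.
  apply/measurable_EFinP; apply: measurable_funM => //; apply: measurable_tensor => j.
  rewrite /sweep; case: ifP => _.
    have mj (f : R -> R) (k l : R) : measurable_fun setT f -> measurable_fun setT (jump f k l).
      by move=> mf; apply: measurable_funB; apply: (measurableT_comp mf); exact: measurable_funB.
    by apply: (mj _ _ _ (mj _ _ _ _)); exact: measurable_maxr.
  have -> : jump heaviside (a ord0 j) (b ord0 j) = \1_(`]a ord0 j, b ord0 j]%classic).
    by apply/funext => t; rewrite jump_heaviside.
  exact: (@measurable_indic _ (measurableTypeR R)).
move=> x _; rewrite -EFinM !abse_EFin lee_fin !normrM normr_id mulrCA.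
apply: ler_wpM2l => //.
rewrite -normrM [leRHS]ger0_norm; last first.
  by rewrite mulr_ge0 ?exprn_ge0 ?addr_ge0// indicE.
apply: tensor_box => [j t|j t]; first exact: sweep_bound.
by apply: sweep_support => //; rewrite mxE.
Qed.

End line_integral.

(** * The difference of a translate as an integral of the weak derivative *)

Section translation_bound.
Context {R : realType} {n : nat}.
Local Notation T := 'rV[R]_n.
Local Notation mu := (lebesgue_rV n : {sigma_finite_measure set T -> \bar R}).
Local Notation leb := (@lebesgue_measure R).
Variables (i : 'I_n) (s : R).
Hypothesis s0 : 0 <= s.
Local Notation e := (delta_mx ord0 i : T).
Implicit Types (g p q r u w : T -> R) (a b : T).

Lemma pospart_ge0 (t : R) : 0 <= pospart t.
Proof. by rewrite /pospart le_max lexx orbT. Qed.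

Lemma pospartBN (t : R) : pospart t - pospart (- t) = t.
Proof.
rewrite /pospart.
by have [h|h] := leP t 0; have [h'|h'] := leP (- t) 0; lra.
Qed.

Lemma pospart_le_norm (t : R) : pospart t <= `|t|.
Proof. by rewrite /pospart ge_max normr_ge0 ler_norm. Qed.

Lemma square_integrable_le u g : measurable_fun setT g -> (forall x, `|g x| <= `|u x|) ->
  square_integrable u -> square_integrable g.
Proof.
move=> mg gu [mu_ iu]; split=> //; apply: le_lt_trans iu; apply: ge0_le_integral => //.
- by move=> x _; rewrite lee_fin sqr_ge0.
- by apply/measurable_EFinP; exact: measurable_funX.
- by apply/measurable_EFinP; exact: measurable_funX.
- by move=> x _; rewrite lee_fin -(real_normK (num_real (g x))) -(real_normK (num_real (u x))) lerXn2r ?nnegrE.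
Qed.

Lemma measurable_pospart u : measurable_fun setT u ->
  measurable_fun setT (fun x => pospart (u x)).
Proof. by move=> mu_; apply: measurable_maxr. Qed.

Lemma square_integrable_pos u : square_integrable u -> square_integrable (fun x => pospart (u x)).
Proof.
move=> su; have [mu_ _] := su; apply: square_integrable_le su; first exact: measurable_pospart.
by move=> x; rewrite ger0_norm ?pospart_ge0 ?pospart_le_norm.
Qed.

Lemma square_integrable_neg u : square_integrable u -> square_integrable (fun x => pospart (- u x)).
Proof.
move=> su; have [mu_ _] := su; apply: square_integrable_le su.
  by apply: measurable_pospart; exact: measurable_funN.
by move=> x; rewrite ger0_norm ?pospart_ge0// -normrN pospart_le_norm.
Qed.

(** Formally, u(x + s e_i) - u(x) is the integral of w on the segment from x to
    x + s e_i. With positive and negative parts moved to opposite sides this is an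
    equality between two nonnegative functions of this shape, which are densities
    of measures. *)
Definition balance p q r (x : T) : \bar R :=
  ((p (x + s *: e)%R)%:E + (q x)%:E + line_integral i s r x)%E.

Section balance.
Variables p q r : T -> R.
Hypotheses (p0 : forall x, 0 <= p x) (q0 : forall x, 0 <= q x) (r0 : forall x, 0 <= r x).
Hypotheses (sp : square_integrable p) (sq : square_integrable q) (sr : square_integrable r).

Lemma balance_ge0 x : (0 <= balance p q r x)%E.
Proof.
by apply: adde_ge0; [rewrite adde_ge0 ?lee_fin|exact: line_integral_ge0].
Qed.

Let measurable_shifted : measurable_fun setT (fun x : T => (p (x + s *: e))%:E).
Proof.
apply/measurable_EFinP; have [mp _] := sp; apply: (measurableT_comp mp).
exact: measurable_shift.
Qed.

Let measurable_q : measurable_fun setT (EFin \o q).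
Proof. by apply/measurable_EFinP; have [] := sq. Qed.

Lemma measurable_balance : measurable_fun setT (balance p q r).
Proof.
apply: emeasurable_funD; last by apply: measurable_line_integral => //; have [] := sr.
by apply: emeasurable_funD.
Qed.

(** All three terms are put in the form of an integral over the whole space: the
    first by translation, the last one by [integral_sweep]. *)
Lemma integral_balance a b : (forall j, a ord0 j <= b ord0 j) ->
  (\int[mu]_(x in box a b) balance p q r x =
   (\int[mu]_x (p x * \1_(box a b) (x - s *: e)) + \int[mu]_x (q x * \1_(box a b) x) +
    \int[mu]_x (r x * tensor (sweep a b s i) x))%:E)%E.
Proof.
move=> ab; have mB := measurable_box a b.
have [mp _] := sp; have [mq _] := sq; have [mr _] := sr.
rewrite ge0_integralD//; last 4 first.
- by move=> x _; rewrite adde_ge0 ?lee_fin.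
- by apply: measurable_funTS; exact: emeasurable_funD.
- by move=> x _; exact: line_integral_ge0.
- by apply: measurable_funTS; exact: measurable_line_integral.
rewrite ge0_integralD//; last 4 first.
- by move=> x _; rewrite lee_fin.
- exact: measurable_funTS.
- by move=> x _; rewrite lee_fin.
- exact: measurable_funTS.
rewrite !EFinD; congr (_ + _ + _)%E.
- rewrite fineK; last first.
    by apply: integrable_fin_num => //; exact: integrable_indic_box_shift.
  rewrite -(integral_shift (s *: e) (f := fun x => (p x * \1_(box a b) (x - s *: e))%:E)).
  + rewrite [LHS]integral_mkcond; apply: eq_integral => x _.
    by rewrite patchE addrK indicE; case: ifPn => _; rewrite ?mulr1 ?mulr0.
  + have := integrable_indic_box_shift a b (s *: e) sp.
    by move=> /integrableP[].
  + by move=> x; rewrite lee_fin mulr_ge0// indicE.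
- rewrite fineK; last first.
    by apply: integrable_fin_num => //; exact: integrable_indic_box.
  rewrite [LHS]integral_mkcond; apply: eq_integral => x _.
  by rewrite patchE indicE; case: ifPn => _; rewrite ?mulr1 ?mulr0.
- rewrite fineK; last first.
    by apply: integrable_fin_num => //; exact: integrable_sweep.
  exact: integral_sweep.
Qed.

End balance.

Lemma Rintegral_pospart u (h : T -> R) :
  mu.-integrable setT (fun x => (pospart (u x) * h x)%:E) ->
  mu.-integrable setT (fun x => (pospart (- u x) * h x)%:E) ->
  \int[mu]_x (u x * h x) =
  \int[mu]_x (pospart (u x) * h x) - \int[mu]_x (pospart (- u x) * h x).
Proof.
move=> i1 i2; rewrite -RintegralB//; apply: eq_Rintegral => x _.
by rewrite -mulrBl pospartBN.
Qed.

(** On boxes the two sides agree by [weak_partial_sweep], so they agree almost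
    everywhere. *)
Lemma weak_partial_balance u w : square_integrable u -> square_integrable w ->
  real_weak_partial i u w ->
  {ae mu, forall x,
    balance (fun y => pospart (u y)) (fun y => pospart (- u y)) (fun y => pospart (- w y)) x =
    balance (fun y => pospart (- u y)) (fun y => pospart (u y)) (fun y => pospart (w y)) x}.
Proof.
move=> su sw wuw.
have sup := square_integrable_pos su; have sun := square_integrable_neg su.
have swp := square_integrable_pos sw; have swn := square_integrable_neg sw.
apply: density_unique.
- by apply: measurable_balance => // y; exact: pospart_ge0.
- by apply: measurable_balance => // y; exact: pospart_ge0.
- by move=> x; apply: balance_ge0 => y; exact: pospart_ge0.
- by move=> x; apply: balance_ge0 => y; exact: pospart_ge0.
- move=> a b ab; rewrite !integral_balance//; try by move=> y; exact: pospart_ge0.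
  congr EFin.
  have := weak_partial_sweep ab s0 su sw wuw.
  under eq_Rintegral do rewrite tensor_shift_differenceE// mulrBr.
  rewrite RintegralB//; last 2 first.
    exact: integrable_indic_box.
    exact: integrable_indic_box_shift.
  rewrite (@Rintegral_pospart u (fun x => \1_(box a b) x)); last 2 first.
    exact: integrable_indic_box.
    exact: integrable_indic_box.
  rewrite (@Rintegral_pospart u (fun x => \1_(box a b) (x - s *: e))); last 2 first.
    exact: integrable_indic_box_shift.
    exact: integrable_indic_box_shift.
  rewrite (@Rintegral_pospart w (tensor (sweep a b s i))); last 2 first.
    exact: integrable_sweep.
    exact: integrable_sweep.
  lra.
- move=> k; rewrite integral_balance ?ltry//; try by move=> y; exact: pospart_ge0.
  by move=> j; rewrite !mxE; have := ler0n R k; lra.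
Qed.

End translation_bound.

(** * The translation estimate *)

Section translation.
Context {R : realType} {n : nat}.
Local Notation T := 'rV[R]_n.
Local Notation mu := (lebesgue_rV n : {sigma_finite_measure set T -> \bar R}).
Local Notation leb := (@lebesgue_measure R).
Implicit Types (u : T -> R).

(** Cauchy-Schwarz, from 2 h <= c + h^2 / c for every c > 0. Finiteness of the
    left-hand side is part of the conclusion. *)
Lemma integral_sqr_le (s : R) (h : R -> R) : 0 < s -> measurable_fun setT h ->
  (forall t, 0 <= h t) ->
  (\int[leb]_(t in `[0%R, s[) (h t ^+ 2)%:E < +oo ->
   \int[leb]_(t in `[0%R, s[) (h t)%:E < +oo /\
   (\int[leb]_(t in `[0%R, s[) (h t)%:E) ^+ 2 <=
   s%:E * \int[leb]_(t in `[0%R, s[) (h t ^+ 2)%:E)%E.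
Proof.
move=> s0 mh h0.
set I := (\int[leb]_(t in _) (h t)%:E)%E; set J := (\int[leb]_(t in _) _)%E.
move=> Joo.
have I0 : (0 <= I)%E by apply: integral_ge0 => t _; rewrite lee_fin.
have J0 : (0 <= J)%E by apply: integral_ge0 => t _; rewrite lee_fin sqr_ge0.
have [B JE] : exists B, J = B%:E by exists (fine J); rewrite fineK// ge0_fin_numE.
have icst (k : R) : (\int[leb]_(t in `[0%R, s[) k%:E = (k * s)%:E)%E.
  rewrite (integral_cst leb (D := `[0%R, s[%classic) (measurable_itv _) k%:E).
  rewrite EFinM; congr (_ * _)%E; rewrite [LHS](lebesgue_measure_itv `[0%R, s[)/= lte_fin s0.
  by rewrite oppr0 adde0.
have leI c : 0 < c -> (I <= (2^-1 * (c * s + B / c))%:E)%E.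
  move=> c0.
  have -> : (2^-1 * (c * s + B / c))%:E =
      (\int[leb]_(t in `[0%R, s[) ((2^-1 * c)%:E + (2^-1 / c)%:E * (h t ^+ 2)%:E))%E.
    rewrite ge0_integralD//; last 3 first.
    - by move=> t _; rewrite lee_fin mulr_ge0// ltW.
    - by move=> t _; rewrite mule_ge0// lee_fin ?sqr_ge0// mulr_ge0// invr_ge0 ltW.
    - apply: measurable_funeM; apply/measurable_EFinP; apply: measurable_funTS.
      exact: measurable_funX.
    rewrite ge0_integralZl_EFin//; last 3 first.
    - by move=> t _; rewrite lee_fin sqr_ge0.
    - apply/measurable_EFinP; apply: measurable_funTS; exact: measurable_funX.
    - by rewrite mulr_ge0// invr_ge0 ltW.
    rewrite -/J JE icst.
    by rewrite -!EFinM -EFinD; congr EFin; field; rewrite gt_eqF.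
  apply: ge0_le_integral => //.
  - by move=> t _; rewrite lee_fin.
  - by apply/measurable_EFinP; exact: measurable_funTS.
  - apply: emeasurable_funD => //; apply: measurable_funeM; apply/measurable_EFinP.
    by apply: measurable_funTS; exact: measurable_funX.
  - move=> t _; rewrite -EFinM -EFinD lee_fin -subr_ge0.
    have -> : 2^-1 * c + 2^-1 / c * h t ^+ 2 - h t = 2^-1 / c * (h t - c) ^+ 2.
      by field; rewrite gt_eqF.
    by rewrite mulr_ge0 ?sqr_ge0// mulr_ge0// invr_ge0 ltW.
have Ioo : (I < +oo)%E by apply: le_lt_trans (leI 1 _) _; rewrite ?ltry.
split=> //.
have IE : I = (fine I)%:E by rewrite fineK// ge0_fin_numE.
rewrite IE JE -EFin_expe -EFinM lee_fin.
have m0 : 0 <= fine I by rewrite fine_ge0.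
have B0 : 0 <= B by move: J0; rewrite JE.
move: m0; rewrite le_eqVlt => /predU1P[<-|m0].
  by rewrite expr0n/= mulr_ge0// ltW.
(* The weight c = I / s makes the two terms balance in the case of equality. *)
have := leI _ (divr_gt0 m0 s0); rewrite IE lee_fin divfK ?gt_eqF// invf_div.
move=> h1; have h2 : fine I <= B * (s / fine I) by move: h1 => /=; lra.
by move: h2; rewrite mulrA ler_pdivlMr// => h2; rewrite /= expr2 [s * B]mulrC.
Qed.

Section coordinate.
Variables (i : 'I_n) (u w : T -> R).
Hypotheses (su : square_integrable u) (sw : square_integrable w).
Hypothesis wuw : real_weak_partial i u w.
Local Notation e := (delta_mx ord0 i : T).

Lemma measurable_along (g : T -> R) x : measurable_fun setT g ->
  measurable_fun setT (fun t : R => g (x + t *: e)).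
Proof.
move=> mg; apply: (measurableT_comp mg); apply: measurable_fun_rVP => j.
under eq_fun do rewrite !mxE.
by apply: measurable_funD => //; apply: measurable_funM.
Qed.

(** Both the positive and the negative part of the integral of w along the segment
    are at most the integral of |w|, which Cauchy-Schwarz bounds. *)
Lemma difference_le_line_integral (s : R) : 0 < s ->
  {ae mu, forall x, ((u (x + s *: e)%R - u x) ^+ 2)%:E <=
     s%:E * line_integral i s (fun y => w y ^+ 2)%R x}%E.
Proof.
move=> s0; have [mw _] := sw.
apply: filterS (weak_partial_balance (ltW s0) su sw wuw) => x.
set J := line_integral i s (fun y => w y ^+ 2)%R x.
have [Joo|] := ltP J +oo%E; last first.
  by rewrite leye_eq => /eqP ->; rewrite gt0_muley ?lte_fin// leey.
have mabs : measurable_fun setT (fun t : R => `|w (x + t *: e)|).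
  by apply: measurableT_comp => //; exact: measurable_along.
have := @integral_sqr_le s (fun t => `|w (x + t *: e)|) s0 mabs (fun t => normr_ge0 _).
under eq_integral do rewrite real_normK ?num_real//.
rewrite -/(line_integral i s (fun y => w y ^+ 2)%R x) -/(line_integral i s (fun y => `|w y|) x) -/J.
move=> /(_ Joo)[Ioo IJ].
set I := line_integral i s _ x in Ioo IJ.
have le_pos : (line_integral i s (fun y => pospart (w y)) x <= I)%E.
  apply: ge0_le_integral => //.
  - by move=> t _; rewrite lee_fin pospart_ge0.
  - apply/measurable_EFinP; apply: measurable_funTS.
    apply: (measurable_along (g := fun y => pospart (w y))).
    exact: measurable_pospart.
  - by apply/measurable_EFinP; exact: measurable_funTS.
  - by move=> t _; rewrite lee_fin pospart_le_norm.
have le_neg : (line_integral i s (fun y => pospart (- w y)) x <= I)%E.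
  apply: ge0_le_integral => //.
  - by move=> t _; rewrite lee_fin pospart_ge0.
  - apply/measurable_EFinP; apply: measurable_funTS.
    apply: (measurable_along (g := fun y => pospart (- w y))).
    by apply: measurable_pospart; exact: measurable_funN.
  - by apply/measurable_EFinP; exact: measurable_funTS.
  - by move=> t _; rewrite lee_fin -normrN pospart_le_norm.
have pos0 : (0 <= line_integral i s (fun y => pospart (w y)) x)%E.
  by apply: line_integral_ge0 => y; exact: pospart_ge0.
have neg0 : (0 <= line_integral i s (fun y => pospart (- w y)) x)%E.
  by apply: line_integral_ge0 => y; exact: pospart_ge0.
rewrite /balance.
move: le_pos le_neg pos0 neg0.
have I0 : (0 <= I)%E by apply: line_integral_ge0 => y; exact: normr_ge0.
have J0 : (0 <= J)%E by apply: line_integral_ge0 => y; exact: sqr_ge0.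
move: I I0 Ioo IJ => [m| |]// I0 _ IJ.
move: J J0 Joo IJ => [B| |]// J0 _ IJ.
case: (line_integral i s (fun y => pospart (w y)) x) => [p| |]//.
case: (line_integral i s (fun y => pospart (- w y)) x) => [q| |]//.
rewrite !lee_fin -!EFinD => pm qm p0 q0 [] E.
move: IJ; rewrite -EFin_expe -EFinM !lee_fin; apply: le_trans.
have := pospartBN (u (x + s *: e)); have := pospartBN (u x) => E1 E2.
have h1 : u (x + s *: e) - u x = p - q by lra.
rewrite h1 -(real_normK (num_real (p - q))) lerXn2r ?nnegrE//.
by rewrite ler_norml; apply/andP; split; lra.
Qed.

Lemma measurable_difference (h : T) :
  measurable_fun setT (fun x : T => ((u (x + h) - u x) ^+ 2)%:E).
Proof.
have [mu_ _] := su; apply/measurable_EFinP; apply: measurable_funX.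
by apply: measurable_funB => //; apply: (measurableT_comp mu_); exact: measurable_shift.
Qed.

(** Integrate the pointwise estimate; each point of a line is then counted for a
    time s. Negative s reduce to positive ones by translation invariance. *)
Lemma translation_le (s : R) :
  (\int[mu]_x ((u (x + s *: e)%R - u x) ^+ 2)%:E <=
   (s ^+ 2)%:E * \int[mu]_x (w x ^+ 2)%:E)%E.
Proof.
have pos t : 0 < t -> (\int[mu]_x ((u (x + t *: e)%R - u x) ^+ 2)%:E <=
   (t ^+ 2)%:E * \int[mu]_x (w x ^+ 2)%:E)%E.
  move=> t0; have [mw _] := sw.
  have mw2 : measurable_fun setT (fun y => w y ^+ 2)%R by exact: measurable_funX.
  have ml : measurable_fun setT (line_integral i t (fun y => w y ^+ 2)%R).
    by apply: measurable_line_integral => // y; exact: sqr_ge0.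
  apply: (@le_trans _ _ (\int[mu]_x (t%:E * line_integral i t (fun y => w y ^+ 2)%R x))%E).
    apply: ae_ge0_le_integral => //.
    - by move=> x _; rewrite lee_fin sqr_ge0.
    - exact: measurable_difference.
    - move=> x _; apply: mule_ge0; first by rewrite lee_fin ltW.
      by apply: line_integral_ge0 => y; exact: sqr_ge0.
    - exact: measurable_funeM.
    - by apply: filterS (difference_le_line_integral t0) => x H _.
  rewrite ge0_integralZl_EFin//; last 2 first.
  - by move=> x _; apply: line_integral_ge0 => y; exact: sqr_ge0.
  - exact: ltW.
  rewrite (integral_line_integral i (ltW t0))//; last by move=> y; exact: sqr_ge0.
  by rewrite muleA -EFinM.
have [s0|s0|->] := ltgtP s 0; last 2 first.
- exact: pos.
- under eq_integral do rewrite scale0r addr0 subrr expr0n/=.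
  by rewrite integral0 expr0n /= mul0e.
have := pos (- s); rewrite oppr_gt0 sqrrN => /(_ s0); apply: le_trans.
rewrite -(integral_shift (- s *: e) (f := fun x => ((u (x + s *: e) - u x) ^+ 2)%:E)).
- rewrite le_eqVlt; apply/orP; left; apply/eqP; apply: eq_integral => x _.
  by rewrite scaleNr subrK -sqrrN opprB.
- exact: measurable_difference.
- by move=> x; rewrite lee_fin sqr_ge0.
Qed.

End coordinate.

(** The translation is done one coordinate at a time, and each step costs a
    factor 2 from (a + b)^2 <= 2 a^2 + 2 b^2. *)
Lemma translation_le_sum (u : T -> R) (w : 'I_n -> T -> R) (h : T) :
  square_integrable u -> (forall i, square_integrable (w i)) ->
  (forall i, real_weak_partial i u (w i)) -> (forall i, `|h ord0 i| <= 1) ->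
  (\int[mu]_x ((u (x + h)%R - u x) ^+ 2)%:E <=
   (2 ^+ n)%:E * \sum_i \int[mu]_x (w i x ^+ 2)%:E)%E.
Proof.
move=> su sw wuw h1; have [mu_ _] := su.
have K0 i : (0 <= \int[mu]_x (w i x ^+ 2)%:E)%E.
  by apply: integral_ge0 => x _; rewrite lee_fin sqr_ge0.
suff key (r : seq 'I_n) :
  (\int[mu]_x ((u (x + \sum_(j <- r) h ord0 j *: delta_mx ord0 j)%R - u x) ^+ 2)%:E <=
   (2 ^+ size r)%:E * \sum_(j <- r) \int[mu]_x (w j x ^+ 2)%:E)%E.
  have := key (enum 'I_n); rewrite size_enum_ord !big_enum/=.
  by rewrite -row_sum_delta.
elim: r => [|j r IH].
  rewrite !big_nil mule0; under eq_integral do rewrite addr0 subrr expr0n/=.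
  by rewrite integral0.
rewrite !big_cons /=; set H := (\sum_(_ <- r) _)%R in IH *.
set v := h ord0 j *: delta_mx ord0 j.
have mD (k : T) := measurable_difference su k.
apply: (@le_trans _ _ (\int[mu]_x (2%:E * ((u (x + v + H)%R - u (x + v)%R) ^+ 2)%:E +
    2%:E * ((u (x + v)%R - u x) ^+ 2)%:E))%E).
  apply: ge0_le_integral => //.
  - by move=> x _; rewrite lee_fin sqr_ge0.
  - apply: emeasurable_funD; apply: measurable_funeM => //.
    apply: (measurableT_comp (mD H)); exact: measurable_shift.
  - move=> x _; rewrite -!EFinM -EFinD lee_fin addrA.
    move: (u (x + v + H)) (u (x + v)) (u x) => A B C.
    rewrite -subr_ge0; have -> : 2 * (A - B) ^+ 2 + 2 * (B - C) ^+ 2 - (A - C) ^+ 2 = (A - B - (B - C)) ^+ 2 by ring.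
    exact: sqr_ge0.
rewrite ge0_integralD//; last 4 first.
- by move=> x _; rewrite mule_ge0// lee_fin sqr_ge0.
- apply: measurable_funeM; apply: (measurableT_comp (mD H)); exact: measurable_shift.
- by move=> x _; rewrite mule_ge0// lee_fin sqr_ge0.
- exact: measurable_funeM.
rewrite !ge0_integralZl_EFin//; last 3 first.
- by move=> x _; rewrite lee_fin sqr_ge0.
- by move=> x _; rewrite lee_fin sqr_ge0.
- apply: (measurableT_comp (mD H)); exact: measurable_shift.
rewrite (integral_shift v (f := fun x => ((u (x + H) - u x) ^+ 2)%:E))//; last first.
  by move=> x; rewrite lee_fin sqr_ge0.
have S0 : (0 <= \sum_(k <- r) \int[mu]_x (w k x ^+ 2)%:E)%E by exact: sume_ge0.
rewrite exprS EFinM -muleA -muleDr//; last first.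
  by apply: ge0_adde_def; rewrite inE; apply: integral_ge0 => x _; rewrite lee_fin sqr_ge0.
apply: lee_wpmul2l => //; rewrite addeC ge0_muleDr//.
apply: leeD => //.
apply: (le_trans (translation_le su (sw j) (wuw j) (h ord0 j))).
apply: lee_wpmul2r => //; rewrite lee_fin.
rewrite -(real_normK (num_real (h ord0 j))).
apply: (@le_trans _ _ 1); first by rewrite expr_le1.
by rewrite exprn_ege1// ler1n.
Qed.

End translation.

(** * A Poincare inequality on all unit cells *)

Section poincare.
Context {R : realType} {n : nat}.
Local Notation T := 'rV[R]_n.
Local Notation mu := (lebesgue_rV n : {sigma_finite_measure set T -> \bar R}).

(** The index of the half-open unit cell that contains x. Half-open cells cover
    the whole space, so that no null set has to be discarded. *)
Definition center (x : T) : 'rV[int]_n := floor_rV (x + const_mx 2^-1).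

Lemma measurable_center_comp d (U : measurableType d) (g : 'rV[int]_n -> U) :
  measurable_fun setT (fun x => g (center x)).
Proof.
apply: (measurableT_comp (measurable_floor_comp g)); exact: measurable_shift.
Qed.

Lemma center_bounds (x : T) i :
  (center x ord0 i)%:~R - 2^-1 <= x ord0 i < (center x ord0 i)%:~R + 2^-1.
Proof.
rewrite /center mxE !mxE; have := floor_le (x ord0 i + 2^-1).
have := floorD1_gt (x ord0 i + 2^-1); rewrite intrD => h1 h2.
by apply/andP; split; lra.
Qed.

Lemma center_unit_cube (j : 'rV[int]_n) (x : T) : unit_cube j x -> center x = j.
Proof.
move=> xj; apply/rowP => i; rewrite /center mxE !mxE; apply: floor_def.
by have /andP[h1 h2] := xj i; rewrite intrD; apply/andP; split; lra.
Qed.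

(** A cube of side r / n about a point lies inside the ball of radius r; the factor
    1/2 makes the inequality strict. Cubes are preferred to balls because their
    volume is explicit. *)
Lemma euclid_lt (x : T) (r : R) : (0 < n)%N -> 0 < r ->
  (forall i, `|x ord0 i| <= r / (2 * n%:R)) -> euclid x < r.
Proof.
move=> n0 r0 xr; have n1 : (0 : R) < n%:R by rewrite ltr0n.
rewrite /euclid -(ltr_pXn2r (n := 2))// ?nnegrE ?sqrtr_ge0 ?ltW//.
rewrite sqr_sqrtr; last by apply: sumr_ge0 => i _; rewrite sqr_ge0.
apply: (@le_lt_trans _ _ (\sum_(i < n) (r / (2 * n%:R)) ^+ 2)).
  apply: ler_sum => i _; rewrite -(real_normK (num_real (x ord0 i))).
  by rewrite lerXn2r ?nnegrE// divr_ge0 ?mulr_ge0 ?ltW.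
rewrite sumr_const card_ord -[ltLHS]mulr_natr.
have n1' : (1 : R) <= n%:R by rewrite ler1n.
have -> : (r / (2 * n%:R)) ^+ 2 * n%:R = r ^+ 2 / (4 * n%:R) by field; rewrite gt_eqF.
have r2 : 0 < r ^+ 2 by rewrite exprn_gt0.
by rewrite ltr_pdivrMr ?mulr_gt0// ltr_pMr//; lra.
Qed.

Lemma measurable_equidistributed_set (delta : R) (Z : 'rV[int]_n -> T) :
  measurable (equidistributed_set delta Z).
Proof.
apply: countable_bigcupT_measurable; first exact: countableP.
move=> j; have me : measurable_fun setT (fun y : T => euclid (y - Z j)).
  apply: (measurableT_comp (f := @Num.sqrt R)).
    by apply: continuous_measurable_fun => x; exact: sqrt_continuous.
  apply: measurable_sum => i; apply: measurable_funX.
  by apply: (measurableT_comp (measurable_coord i)); exact: measurable_shift.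
have := me measurableT _ (measurable_itv `]-oo, delta[).
rewrite setTI; congr measurable.
Qed.

Variables (delta : R) (Z : 'rV[int]_n -> T).
Hypotheses (n0 : (0 < n)%N) (delta_gt0 : 0 < delta) (eqZ : equidistributed delta Z).

Let r := delta / (2 * n%:R).
Let B : set T := box (const_mx (- r)) (const_mx r).
Let B1 : set T := box (const_mx (- 1)) (const_mx 1).
Local Notation S := (equidistributed_set delta Z).

(** A point y of the small cube at the centre belonging to x lies in S and in the
    cell of x: hence it is close to x, and x is close to the centre of the cell of
    y. Three conditions on pairs come out, each of which is a fixed box around a
    point depending on one variable only. *)
Lemma near_center (x y : T) : B (y - Z (center x)) ->
  [/\ S y, B1 (x - \row_i (center y ord0 i)%:~R) & B1 (y - x)].
Proof.
move=> Bxy; have yb : euclid_ball delta (Z (center x)) y.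
  apply: euclid_lt => // i; have := Bxy i; rewrite in_itv/= !mxE => /andP[h1 h2].
  by rewrite ler_norml h2 ltW.
have cxy : center y = center x by apply: center_unit_cube; exact: eqZ.
split; first by exists (center x).
  move=> i; rewrite in_itv/= !mxE -/(floor_rV _ _ _).
  by have := center_bounds x i; rewrite -cxy => /andP[h1 h2]; move: h1 h2;
     rewrite /center !mxE => h1 h2; apply/andP; split; lra.
move=> i; rewrite in_itv/= !mxE.
have /andP[h1 h2] := center_bounds x i; have := center_bounds y i; rewrite cxy.
by move=> /andP[h3 h4]; apply/andP; split; lra.
Qed.

Lemma lebesgue_B : mu B = ((delta / n%:R) ^+ n)%:E.
Proof.
have n1 : (0 : R) < n%:R by rewrite ltr0n.
have r0 : 0 < r by rewrite divr_gt0// mulr_gt0.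
rewrite lebesgue_box => [|i]; last by rewrite !mxE; lra.
under eq_bigr do rewrite !mxE opprK.
rewrite prodr_const card_ord; congr (_ ^+ _)%:E.
by rewrite /r; field; rewrite gt_eqF.
Qed.

Lemma lebesgue_B1 : mu B1 = (2 ^+ n)%:E.
Proof.
rewrite lebesgue_box => [|i]; last by rewrite !mxE; lra.
under eq_bigr do rewrite !mxE opprK.
by rewrite prodr_const card_ord.
Qed.

Lemma integral_indic_shift (a b h : T) : (\int[mu]_x (\1_(box a b) (x - h)%R)%:E = mu (box a b))%E.
Proof.
rewrite (integral_shift (- h) (f := fun x => (\1_(box a b) x)%:E)) //.
- by rewrite integral_indic ?setIT//; exact: measurable_box.
- by apply/measurable_EFinP; exact: measurable_indic_box.
Qed.

(** For every pair with y in the small cube at the centre belonging to x one has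
    u(x)^2 <= 2 u(y)^2 + 2 (u(y) - u(x))^2. The integral over all such pairs
    gives, by [near_center], the mass of u times the volume of the small cube on
    the left, and on the right the mass of u on S together with differences of
    translates by vectors of the unit box, which [translation_le_sum] bounds. *)
Lemma poincare (u : T -> R) (w : 'I_n -> T -> R) : square_integrable u ->
  (forall i, square_integrable (w i)) -> (forall i, real_weak_partial i u (w i)) ->
  (((delta / n%:R) ^+ n)%:E * \int[mu]_x (u x ^+ 2)%:E <=
   2%:E * ((2 ^+ n)%:E * \int[mu]_x (\1_S x * u x ^+ 2)%:E) +
   2%:E * ((2 ^+ n)%:E * ((2 ^+ n)%:E * \sum_i \int[mu]_x (w i x ^+ 2)%:E)))%E.
Proof.
move=> su sw wuw; have [mu_ _] := su.
have mS := measurable_equidistributed_set delta Z.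
have mI (a b : T) : measurable_fun setT (\1_(box a b) : T -> R) by exact: measurable_indic_box.
have I0 (A : set T) x : 0 <= \1_A x :> R by rewrite indicE.
have mu1 : measurable_fun setT (fun z : T * T => u z.1) by exact: (measurableT_comp mu_ measurable_fst).
have mu2 : measurable_fun setT (fun z : T * T => u z.2) by exact: (measurableT_comp mu_ measurable_snd).
have msub (f g : T * T -> T) : measurable_fun setT f -> measurable_fun setT g ->
    measurable_fun setT (fun z => f z - g z).
  move=> mf mg; apply: measurable_fun_rVP => i; under eq_fun do rewrite !mxE.
  by apply: measurable_funB; apply: (measurableT_comp (measurable_coord i)).
have mcen (g : 'rV[int]_n -> T) : measurable_fun setT (fun x : T => g (center x)).
  exact: measurable_center_comp.
(* In f1 the second variable is free in a small cube, in f2 the first one is free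
   in a unit box, and f3 depends on the difference: each integral factors after
   integration in the free variable. *)
pose f1 (z : T * T) := (\1_B (z.2 - Z (center z.1)) * u z.1 ^+ 2)%:E : \bar R.
pose f2 (z : T * T) := (\1_B1 (z.1 - \row_i (center z.2 ord0 i)%:~R) * (\1_S z.2 * u z.2 ^+ 2))%:E : \bar R.
pose f3 (z : T * T) := (\1_B1 (z.2 - z.1) * (u z.2 - u z.1) ^+ 2)%:E : \bar R.
have f1_0 z : (0 <= f1 z)%E by rewrite lee_fin mulr_ge0 ?sqr_ge0.
have f2_0 z : (0 <= f2 z)%E.
  by rewrite lee_fin; do 2!apply: mulr_ge0 => //; exact: sqr_ge0.
have f3_0 z : (0 <= f3 z)%E by rewrite lee_fin mulr_ge0 ?sqr_ge0.
have mf1 : measurable_fun setT f1.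
  apply/measurable_EFinP; apply: measurable_funM; last exact: measurable_funX.
  apply: (measurableT_comp (mI _ _)); apply: msub => //; exact: (measurableT_comp (mcen Z)).
have mf2 : measurable_fun setT f2.
  apply/measurable_EFinP; apply: measurable_funM.
    apply: (measurableT_comp (mI _ _)); apply: msub => //.
    exact: (measurableT_comp (mcen (fun j => \row_i (j ord0 i)%:~R))).
  apply: measurable_funM; last exact: measurable_funX.
  by apply: (measurableT_comp (measurable_indic mS)).
have mf3 : measurable_fun setT f3.
  apply/measurable_EFinP; apply: measurable_funM.
    by apply: (measurableT_comp (mI _ _)); apply: msub.
  by apply: measurable_funX; exact: measurable_funB.
have le123 z : (f1 z <= 2%:E * f2 z + 2%:E * f3 z)%E.
  rewrite /f1 [\1_B _]indicE; have [Bz|nBz] := pselect (B (z.2 - Z (center z.1))); last first.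
    rewrite memNset// mul0r; apply: adde_ge0; apply: mule_ge0 => //; exact: f2_0.
  rewrite mem_set// /f2 /f3 !indicE; have [Sz B1z B1z'] := near_center Bz.
  rewrite !mem_set// !mul1r -!EFinM -EFinD lee_fin -subr_ge0.
  move: (u z.1) (u z.2) => a b.
  have -> : 2 * b ^+ 2 + 2 * (b - a) ^+ 2 - a ^+ 2 = (2 * b - a) ^+ 2 by ring.
  exact: sqr_ge0.
have E1 : (\int[mu \x mu]_z f1 z = ((delta / n%:R) ^+ n)%:E * \int[mu]_x (u x ^+ 2)%:E)%E.
  rewrite fubini_tonelli1//.
  rewrite -ge0_integralZl_EFin//; last 3 first.
  - by move=> x _; rewrite lee_fin sqr_ge0.
  - by apply/measurable_EFinP; exact: measurable_funX.
  - by rewrite exprn_ge0// divr_ge0// ltW.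
  apply: eq_integral => x _; rewrite /fubini_F /f1 /=.
  under eq_integral do rewrite mulrC EFinM.
  rewrite ge0_integralZl_EFin ?sqr_ge0//; last first.
    apply/measurable_EFinP; apply: (measurableT_comp (mI _ _)); exact: measurable_shift.
  by rewrite integral_indic_shift lebesgue_B muleC.
have E2 : (\int[mu \x mu]_z f2 z = (2 ^+ n)%:E * \int[mu]_x (\1_S x * u x ^+ 2)%:E)%E.
  rewrite fubini_tonelli2//.
  rewrite -ge0_integralZl_EFin//; last 2 first.
  - by move=> x _; rewrite lee_fin mulr_ge0// sqr_ge0.
  - apply/measurable_EFinP; apply: measurable_funM; last exact: measurable_funX.
    exact: measurable_indic.
  apply: eq_integral => y _; rewrite /fubini_G /f2 /=.
  under eq_integral do rewrite mulrC EFinM.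
  have Su0 : 0 <= \1_S y * u y ^+ 2 by apply: mulr_ge0 => //; exact: sqr_ge0.
  rewrite ge0_integralZl_EFin//; last first.
    apply/measurable_EFinP; apply: (measurableT_comp (mI _ _)); exact: measurable_shift.
  by rewrite integral_indic_shift lebesgue_B1 muleC.
have E3 : (\int[mu \x mu]_z f3 z <=
    (2 ^+ n)%:E * ((2 ^+ n)%:E * \sum_i \int[mu]_x (w i x ^+ 2)%:E))%E.
  rewrite fubini_tonelli1//.
  (* The integral of f3 in the variables x and h = y - x. *)
  pose f4 (z : T * T) := (\1_B1 z.2 * (u (z.1 + z.2) - u z.1) ^+ 2)%:E : \bar R.
  have f4_0 z : (0 <= f4 z)%E by rewrite lee_fin mulr_ge0 ?sqr_ge0.
  have mf4 : measurable_fun setT f4.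
    apply/measurable_EFinP; apply: measurable_funM.
      exact: (measurableT_comp (mI _ _)).
    apply: measurable_funX; apply: measurable_funB => //.
    apply: (measurableT_comp mu_); exact: measurable_addv.
  rewrite (eq_integral (fun x => \int[mu]_h f4 (x, h))%E); last first.
    move=> x _; rewrite /fubini_F -(integral_shift x (f := fun y => f3 (x, y))).
    - by apply: eq_integral => h _; rewrite /f3 /f4 /= addrK [h + x]addrC.
    - exact: (measurableT_comp mf3 (measurable_pair1 x)).
    - by move=> y; exact: f3_0.
  rewrite (@fubini_tonelli _ _ _ _ _ mu mu f4 mf4 f4_0).
  set K := (_ * \sum_i _)%E.
  have K0 : (0 <= K)%E.
    rewrite /K mule_ge0// sume_ge0// => i _; apply: integral_ge0 => x _.
    by rewrite lee_fin sqr_ge0.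
  have mE : measurable_fun setT (fun h : T => (\1_B1 h : R)%:E).
    by apply/measurable_EFinP; exact: mI.
  have -> : ((2 ^+ n)%:E * K = \int[mu]_h ((\1_B1 h)%:E * K))%E.
    rewrite ge0_integralZr//.
    rewrite integral_indic//; last exact: measurable_box.
    by rewrite setIT -lebesgue_B1.
  apply: ge0_le_integral => //.
  - by move=> h _; apply: integral_ge0 => x _; exact: f4_0.
  - exact: measurable_fun_fubini_tonelli_G.
  - exact: emeasurable_funM.
  - move=> h _; rewrite /f4 /= indicE; have [B1h|nB1h] := pselect (B1 h); last first.
      rewrite memNset//; under eq_integral do rewrite mul0r.
      by rewrite integral0 mul0e.
    rewrite mem_set// mul1e; under eq_integral do rewrite mul1r.
    apply: translation_le_sum => // i; have := B1h i; rewrite in_itv/= !mxE.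
    by move=> /andP[h1 h2]; rewrite ler_norml h2 ltW.
rewrite -E1 -E2; apply: (@le_trans _ _ (\int[mu \x mu]_z (2%:E * f2 z + 2%:E * f3 z))%E).
  apply: ge0_le_integral => //.
  by apply: emeasurable_funD; exact: measurable_funeM.
rewrite ge0_integralD//; last 4 first.
- by move=> z _; rewrite mule_ge0.
- exact: measurable_funeM.
- by move=> z _; rewrite mule_ge0.
- exact: measurable_funeM.
rewrite !ge0_integralZl_EFin//.
by apply: leeD => //; apply: lee_wpmul2l.
Qed.

End poincare.

(** * The complex Hilbert space *)

Section complex_L2.
Context {R : realType} {n : nat}.
Local Notation T := 'rV[R]_n.
Local Notation mu := (lebesgue_rV n : {sigma_finite_measure set T -> \bar R}).
Local Notation Re := complex.Re.
Local Notation Im := complex.Im.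
Local Open Scope complex_scope.
Implicit Types (u v w f : T -> R[i]).

Lemma Re_normC_sqr (z : R[i]) : Re `|z| ^+ 2 = Re z ^+ 2 + Im z ^+ 2.
Proof.
case: z => a b; rewrite /= sqr_sqrtr//.
by rewrite addr_ge0 ?sqr_ge0.
Qed.

Lemma Re_mul_conj (z t : R[i]) : Re (z * t^*) = Re z * Re t + Im z * Im t.
Proof. by case: z t => a b [c d] /=; ring. Qed.

Lemma Im_mul_conj (z t : R[i]) : Im (z * t^*) = Im z * Re t - Re z * Im t.
Proof. by case: z t => a b [c d] /=; ring. Qed.

Lemma Re_mul_real (z : R[i]) (r : R) : Re (z * r%:C) = Re z * r.
Proof. by case: z => a b /=; ring. Qed.

Lemma Im_mul_real (z : R[i]) (r : R) : Im (z * r%:C) = Im z * r.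
Proof. by case: z => a b /=; ring. Qed.

Lemma integral_normC_sqr u : measurable_fun setT (fun x => Re (u x)) ->
  measurable_fun setT (fun x => Im (u x)) ->
  (\int[mu]_x (Re `|u x| ^+ 2)%:E =
   \int[mu]_x (Re (u x) ^+ 2)%:E + \int[mu]_x (Im (u x) ^+ 2)%:E)%E.
Proof.
move=> mR mI; under eq_integral do rewrite Re_normC_sqr EFinD.
rewrite ge0_integralD//; try by move=> x _; rewrite lee_fin sqr_ge0.
- by apply/measurable_EFinP; exact: measurable_funX.
- by apply/measurable_EFinP; exact: measurable_funX.
Qed.

(** A complex function is treated through its real and imaginary parts, to which
    the real Poincare inequality applies separately. *)
Lemma L2_square_integrable u :
  L2 u <-> square_integrable (fun x => Re (u x)) /\ square_integrable (fun x => Im (u x)).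
Proof.
have I0 (g : T -> R) : (0 <= \int[mu]_x (g x ^+ 2)%:E)%E.
  by apply: integral_ge0 => x _; rewrite lee_fin sqr_ge0.
split=> [[[mR mI]]|[[mR iR] [mI iI]]].
  rewrite integral_normC_sqr// => ioo.
  split; split=> //; apply: le_lt_trans ioo; [exact: leeDl|exact: leeDr].
by split=> //; rewrite integral_normC_sqr// lte_add_pinfty.
Qed.

Lemma weak_partial_Re i u w : weak_partial i u w ->
  real_weak_partial i (fun x => Re (u x)) (fun x => Re (w x)).
Proof.
move=> uw phi /uw; rewrite /cintegral => -[+ _].
have e g (psi : T -> R) : \int[mu]_x Re (g x * (psi x)%:C) = \int[mu]_x (Re (g x) * psi x).
  by apply: eq_Rintegral => x _; exact: Re_mul_real.
by rewrite !e.
Qed.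

Lemma weak_partial_Im i u w : weak_partial i u w ->
  real_weak_partial i (fun x => Im (u x)) (fun x => Im (w x)).
Proof.
move=> uw phi /uw; rewrite /cintegral => -[_ +].
have e g (psi : T -> R) : \int[mu]_x Im (g x * (psi x)%:C) = \int[mu]_x (Im (g x) * psi x).
  by apply: eq_Rintegral => x _; exact: Im_mul_real.
by rewrite !e.
Qed.

(** The product is bounded by the sum of the squares. *)
Lemma square_integrable_mul (g h : T -> R) : square_integrable g -> square_integrable h ->
  mu.-integrable setT (fun x => (g x * h x)%:E).
Proof.
move=> [mg ig] [mh ih].
have int2 (k : T -> R) : measurable_fun setT k -> (\int[mu]_x (k x ^+ 2)%:E < +oo)%E ->
    mu.-integrable setT (fun x => (k x ^+ 2)%:E).
  move=> mk ik; apply/integrableP; split; first by apply/measurable_EFinP; exact: measurable_funX.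
  by under eq_integral do rewrite gee0_abs ?lee_fin ?sqr_ge0//.
apply: le_integrable (integrableD measurableT (int2 _ mg ig) (int2 _ mh ih)) => //.
  by apply/measurable_EFinP; exact: measurable_funM.
move=> x _; rewrite -EFinD !abse_EFin lee_fin [leRHS]ger0_norm ?addr_ge0 ?sqr_ge0//.
rewrite normrM -(real_normK (num_real (g x))) -(real_normK (num_real (h x))).
have := normr_ge0 (g x); have := normr_ge0 (h x); nra.
Qed.

Lemma integrable_Re_inner u v : L2 u -> L2 v ->
  mu.-integrable setT (fun x => (Re (u x * (v x)^*))%:E).
Proof.
move=> /L2_square_integrable[uR uI] /L2_square_integrable[vR vI].
under eq_fun do rewrite Re_mul_conj EFinD.
by apply: integrableD => //; exact: square_integrable_mul.
Qed.

Lemma integrable_Im_inner u v : L2 u -> L2 v ->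
  mu.-integrable setT (fun x => (Im (u x * (v x)^*))%:E).
Proof.
move=> /L2_square_integrable[uR uI] /L2_square_integrable[vR vI].
under eq_fun do rewrite Im_mul_conj EFinB.
by apply: integrableB => //; exact: square_integrable_mul.
Qed.

Lemma ae_eq_Rintegral (g h : T -> R) : mu.-integrable setT (EFin \o g) ->
  mu.-integrable setT (EFin \o h) -> {ae mu, forall x, g x = h x} ->
  \int[mu]_x g x = \int[mu]_x h x.
Proof.
move=> ig ih gh; congr fine; apply: ae_eq_integral => //.
- by case/integrableP: ig.
- by case/integrableP: ih.
- by apply: filterS gh => x /= -> _.
Qed.

Lemma ae_eq_inner u u' v v' : L2 u -> L2 u' -> L2 v -> L2 v' ->
  u = u' %[ae mu] -> v = v' %[ae mu] -> inner u v = inner u' v'.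
Proof.
move=> Lu Lu' Lv Lv' uu' vv'; rewrite /inner /cintegral.
congr (_ +i* _); apply: ae_eq_Rintegral.
- exact: integrable_Re_inner.
- exact: integrable_Re_inner.
- by apply: filterS2 uu' vv' => x -> // ->.
- exact: integrable_Im_inner.
- exact: integrable_Im_inner.
- by apply: filterS2 uu' vv' => x -> // ->.
Qed.

Lemma inner_real_scale (k : R) u v : L2 u -> L2 v ->
  inner (fun x => k%:C * u x) v = k%:C * inner u v.
Proof.
move=> Lu Lv; rewrite /inner /cintegral.
have eR x : Re (k%:C * u x * (v x)^*) = k * Re (u x * (v x)^*).
  by case: (u x) (v x) => a b [c d] /=; ring.
have eI x : Im (k%:C * u x * (v x)^*) = k * Im (u x * (v x)^*).
  by case: (u x) (v x) => a b [c d] /=; ring.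
under eq_Rintegral do rewrite eR.
under [X in _ +i* X]eq_Rintegral do rewrite eI.
rewrite !RintegralZl//; [|exact: integrable_Im_inner|exact: integrable_Re_inner].
by simpc.
Qed.

Lemma integral_Re_inner_sqr u : L2 u ->
  ((Re (inner u u))%:E = \int[mu]_x (Re (u x) ^+ 2)%:E + \int[mu]_x (Im (u x) ^+ 2)%:E)%E.
Proof.
move=> Lu; have /L2_square_integrable[[mR _] [mI _]] := Lu.
rewrite /= /Rintegral fineK; last exact: integrable_fin_num (integrable_Re_inner Lu Lu).
rewrite -integral_normC_sqr//; apply: eq_integral => x _.
by rewrite Re_mul_conj Re_normC_sqr !expr2.
Qed.

Lemma Re_inner_ge0 u : 0 <= Re (inner u u).
Proof.
apply: Rintegral_ge0 => x _.
by rewrite Re_mul_conj -!expr2 addr_ge0 ?sqr_ge0.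
Qed.

Lemma inner_selfE u : inner u u = (Re (inner u u))%:C.
Proof.
rewrite /inner /cintegral /= [X in _ +i* X](_ : _ = 0)//.
under eq_Rintegral do rewrite Im_mul_conj mulrC subrr.
by rewrite /Rintegral integral0.
Qed.

Lemma L2_mult_indicator (S : set T) u : measurable S -> L2 u -> L2 (mult_indicator S u).
Proof.
move=> mS /L2_square_integrable[uR uI]; apply/L2_square_integrable.
have eR x : Re (mult_indicator S u x) = \1_S x * Re (u x).
  by rewrite /mult_indicator; case: (u x) => a b /=; ring.
have eI x : Im (mult_indicator S u x) = \1_S x * Im (u x).
  by rewrite /mult_indicator; case: (u x) => a b /=; ring.
have key (g : T -> R) : square_integrable g -> square_integrable (fun x => \1_S x * g x).
  move=> sg; have [mg _] := sg; apply: square_integrable_le sg.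
    by apply: measurable_funM => //; exact: measurable_indic.
  move=> x; rewrite normrM ler_piMl// indicE.
  by case: (_ \in _); rewrite ?normr1 ?normr0.
by split; [under eq_fun do rewrite eR|under eq_fun do rewrite eI]; exact: key.
Qed.

(** The inner product on the left is real, as the comparison of complex numbers
    requires, and it is the mass of u on S. *)
Lemma inner_mult_indicator (S : set T) u : measurable S -> L2 u ->
  ((Re (inner (mult_indicator S u) u))%:E =
   \int[mu]_x (\1_S x * Re (u x) ^+ 2)%:E + \int[mu]_x (\1_S x * Im (u x) ^+ 2)%:E)%E /\
  Im (inner (mult_indicator S u) u) = 0.
Proof.
move=> mS Lu; have LW := L2_mult_indicator mS Lu; split.
  rewrite /= /Rintegral fineK; last exact: integrable_fin_num (integrable_Re_inner LW Lu).
  have /L2_square_integrable[[mR _] [mI _]] := Lu.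
  rewrite -ge0_integralD//; last 4 first.
  - by move=> x _; rewrite lee_fin indicE mulr_ge0 ?sqr_ge0.
  - by apply/measurable_EFinP; apply: measurable_funM; [exact: measurable_indic|exact: measurable_funX].
  - by move=> x _; rewrite lee_fin indicE mulr_ge0 ?sqr_ge0.
  - by apply/measurable_EFinP; apply: measurable_funM; [exact: measurable_indic|exact: measurable_funX].
  apply: eq_integral => x _; rewrite -EFinD; congr EFin.
  by rewrite /mult_indicator; case: (u x) => a b /=; ring.
rewrite /=; have e x : Im (mult_indicator S u x * (u x)^*) = 0.
  by rewrite /mult_indicator; case: (u x) => a b /=; ring.
under eq_Rintegral do rewrite e.
by rewrite /Rintegral integral0.
Qed.

End complex_L2.

(** * The form bounds the gradient *)

Section form_bounds.
Context {R : realType} {n : nat}.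
Local Notation T := 'rV[R]_n.
Local Notation mu := (lebesgue_rV n : {sigma_finite_measure set T -> \bar R}).
Local Notation Re := complex.Re.
Local Notation Im := complex.Im.
Local Open Scope complex_scope.

Lemma euclid_le_sum (x : T) : euclid x <= \sum_i `|x ord0 i|.
Proof.
have S0 : 0 <= \sum_i `|x ord0 i| by exact: sumr_ge0.
rewrite /euclid -(ger0_norm S0) -sqrtr_sqr ler_wsqrtr//.
elim: (index_enum _) => [|i r IH]; first by rewrite !big_nil expr0n.
rewrite !big_cons -(real_normK (num_real (x ord0 i))).
have h1 := normr_ge0 (x ord0 i).
have h2 : 0 <= \sum_(j <- r) `|x ord0 j| by exact: sumr_ge0.
apply: (le_trans (lerD (lexx _) IH)).
by rewrite sqrrD addrAC lerDl mulrn_wge0// mulr_ge0.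
Qed.

Lemma entry_le_row_sum_norm (M : 'M[R]_n) i j : `|M i j| <= row_sum_norm M.
Proof.
apply: (@le_trans _ _ (\sum_k `|M i k|)).
  by rewrite (bigD1 j)//= lerDl sumr_ge0.
exact: (le_bigmax _ (fun k => \sum_l `|M k l|) i).
Qed.

(** Lipschitz coefficients are limits of their samples on finer and finer grids. *)
Lemma measurable_lipschitz_entry (L : R) (A : T -> 'M[R]_n) i j :
  lipschitz_matrix L A -> measurable_fun setT (fun x => A x i j).
Proof.
move=> lipA.
pose grid (k : nat) (z : 'rV[int]_n) : T := \row_l ((z ord0 l)%:~R / k.+1%:R).
pose h (k : nat) (x : T) : R := A (grid k (floor_rV (k.+1%:R *: x))) i j.
apply: (@measurable_fun_cvg _ _ _ _ h) => [k|x _].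
  have ms : measurable_fun setT (fun x : T => k.+1%:R *: x).
    apply: measurable_fun_rVP => l; under eq_fun do rewrite mxE.
    by apply: measurable_funM => //; exact: measurable_coord.
  exact: (measurableT_comp (measurable_floor_comp (fun z => A (grid k z) i j : measurableTypeR R)) ms).
have near_grid k : `|h k x - A x i j| <= `|L| * n%:R / k.+1%:R.
  rewrite /h; set y := grid _ _.
  have k0 : (0 : R) < k.+1%:R by rewrite ltr0n.
  have yx l : `|(y - x) ord0 l| <= k.+1%:R^-1.
    rewrite !mxE; have := floor_le (k.+1%:R * x ord0 l); have := floorD1_gt (k.+1%:R * x ord0 l).
    rewrite intrD; set z := (Num.floor _)%:~R => h1 h2.
    have -> : z / k.+1%:R - x ord0 l = (z - k.+1%:R * x ord0 l) / k.+1%:R.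
      by field; rewrite gt_eqF.
    rewrite normrM normfV (ger0_norm (ltW k0)) ler_pdivrMr// mulVf ?gt_eqF//.
    by rewrite ler_norml; apply/andP; split; lra.
  have -> : A y i j - A x i j = (A y - A x) i j by rewrite !mxE.
  apply: (le_trans (entry_le_row_sum_norm _ i j)); apply: (le_trans (lipA y x)).
  apply: (@le_trans _ _ (`|L| * euclid (y - x))).
    by apply: ler_wpM2r; [exact: sqrtr_ge0|exact: ler_norm].
  rewrite -mulrA ler_wpM2l//; apply: (le_trans (euclid_le_sum _)).
  apply: (le_trans (ler_sum _ (fun l _ => yx l))).
  by rewrite sumr_const card_ord mulr_natl.
apply/cvgrPdist_lt => /= eps eps0; near=> k.
rewrite distrC; apply: (le_lt_trans (near_grid k)).
rewrite ltr_pdivrMr ?ltr0n// -ltr_pdivrMl//.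
apply: (@lt_le_trans _ _ k%:R); last by rewrite ler_nat.
by near: k; exact: nbhs_infty_gtr.
Unshelve. all: by end_near. Qed.

Lemma quadratic_formE (M : 'M[R]_n) (a : T) :
  (a *m M *m a^T) ord0 ord0 = \sum_i \sum_j M i j * (a ord0 i * a ord0 j).
Proof.
rewrite mxE exchange_big /=; apply: eq_bigr => j _; rewrite !mxE mulr_suml.
by apply: eq_bigr => i _; ring.
Qed.

Lemma Re_sum (I : Type) (r : seq I) (g : I -> R[i]) :
  Re (\sum_(k <- r) g k) = \sum_(k <- r) Re (g k).
Proof.
elim: r => [|k r IH]; first by rewrite !big_nil.
by rewrite !big_cons raddfD /= IH.
Qed.

(** The products of a real with an imaginary part only enter the imaginary part,
    so the real part is the sum of two real quadratic forms. *)
Lemma Re_form_integrand (M : 'M[R]_n) (w : 'I_n -> R[i]) :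
  Re (\sum_i \sum_j (M i j)%:C * w i * (w j)^*) =
  ((\row_i Re (w i)) *m M *m (\row_i Re (w i))^T) ord0 ord0 +
  ((\row_i Im (w i)) *m M *m (\row_i Im (w i))^T) ord0 ord0.
Proof.
rewrite Re_sum !quadratic_formE -big_split; apply: eq_bigr => i _.
rewrite Re_sum -big_split; apply: eq_bigr => j _; rewrite !mxE.
by case: (w i) (w j) => a b [c d] /=; ring.
Qed.

Lemma euclid_sqr (x : T) : euclid x ^+ 2 = \sum_i x ord0 i ^+ 2.
Proof. by rewrite sqr_sqrtr// sumr_ge0// => i _; rewrite sqr_ge0. Qed.

Lemma dH1P (u : T -> R[i]) i : H1 u -> L2 (dH1 i u) /\ weak_partial i u (dH1 i u).
Proof.
move=> [_ /(_ i)[w Lw uw]]; rewrite /dH1.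
by case: xgetP => [y -> []//|/(_ w)]; case.
Qed.

(** The lower ellipticity bound applies pointwise to the real and to the imaginary
    part of the gradient. The upper bound gives the integrability of the form, and
    hence the meaning of its value as an integral. *)
Lemma ellipticity_gradient (A : T -> 'M[R]_n) (Theta L : R) (u : T -> R[i]) :
  ellipticity_constant A Theta -> lipschitz_matrix L A -> H1 u ->
  (\sum_i (\int[mu]_x (Re (dH1 i u x) ^+ 2)%:E + \int[mu]_x (Im (dH1 i u x) ^+ 2)%:E) <=
   (Theta * Re (Defs.form A u u))%:E)%E.
Proof.
move=> [Th1 ell] lipA Hu; have Th0 : 0 < Theta by exact: lt_le_trans Th1.
pose w i x := dH1 i u x.
have Lw i : L2 (w i) by exact: (dH1P i Hu).1.
have sw i : square_integrable (fun x => Re (w i x)) /\ square_integrable (fun x => Im (w i x)).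
  exact/L2_square_integrable.
pose g x := \sum_i (Re (w i x) ^+ 2 + Im (w i x) ^+ 2).
pose G x := Re (\sum_i \sum_j (A x i j)%:C * w i x * (w j x)^*).
have sE (k : 'I_n -> R) : euclid (\row_i k i) ^+ 2 = \sum_i k i ^+ 2.
  by rewrite euclid_sqr; apply: eq_bigr => i _; rewrite mxE.
have bnd x : Theta^-1 * g x <= G x <= Theta * g x.
  rewrite /G Re_form_integrand; have := ell x (\row_i Re (w i x)); have := ell x (\row_i Im (w i x)).
  rewrite !sE => /andP[h1 h2] /andP[h3 h4].
  by rewrite /g big_split/= !mulrDr; apply/andP; split; lra.
have g0 x : 0 <= g x by apply: sumr_ge0 => i _; rewrite addr_ge0 ?sqr_ge0.
have mg2 (k : T -> R) : square_integrable k -> measurable_fun setT (fun x => (k x ^+ 2)%:E).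
  by move=> [mk _]; apply/measurable_EFinP; exact: measurable_funX.
have intg : (\int[mu]_x (g x)%:E = \sum_i (\int[mu]_x (Re (w i x) ^+ 2)%:E + \int[mu]_x (Im (w i x) ^+ 2)%:E))%E.
  rewrite /g; under eq_integral do rewrite -sumEFin.
  rewrite ge0_integral_sum//; last 2 first.
  - move=> i; have [sR sI] := sw i; under eq_fun do rewrite EFinD.
    by apply: emeasurable_funD; exact: mg2.
  - by move=> i x _; rewrite lee_fin addr_ge0 ?sqr_ge0.
  apply: eq_bigr => i _; have [sR sI] := sw i.
  under eq_integral do rewrite EFinD.
  by rewrite ge0_integralD//; try (by move=> x _; rewrite lee_fin sqr_ge0); exact: mg2.
have goo : (\int[mu]_x (g x)%:E < +oo)%E.
  rewrite intg; apply: lte_sum_pinfty => i _; have [[_ h1] [_ h2]] := sw i.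
  exact: lte_add_pinfty.
have mg : measurable_fun setT (fun x => (g x)%:E).
  apply/measurable_EFinP; apply: measurable_sum => i; have [[mR _] [mI _]] := sw i.
  by apply: measurable_funD; exact: measurable_funX.
have mG : measurable_fun setT (fun x => (G x)%:E).
  apply/measurable_EFinP; rewrite /G; under eq_fun do rewrite Re_sum.
  apply: measurable_sum => i; under eq_fun do rewrite Re_sum.
  apply: measurable_sum => j; have [[miR _] [miI _]] := sw i; have [[mjR _] [mjI _]] := sw j.
  have e x : Re ((A x i j)%:C * w i x * (w j x)^*) =
      A x i j * (Re (w i x) * Re (w j x) + Im (w i x) * Im (w j x)).
    by case: (w i x) (w j x) => a b [c d] /=; ring.
  under eq_fun do rewrite e.
  apply: measurable_funM; first exact: measurable_lipschitz_entry lipA.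
  exact: (measurable_funD (measurable_funM miR mjR) (measurable_funM miI mjI)).
have ig : mu.-integrable setT (fun x => (g x)%:E).
  by apply/integrableP; split=> //; under eq_integral do rewrite gee0_abs ?lee_fin//.
have G0 x : 0 <= G x.
  by have /andP[+ _] := bnd x; apply: le_trans; rewrite mulr_ge0// invr_ge0 ltW.
have iG : mu.-integrable setT (fun x => (G x)%:E).
  apply: le_integrable (integrableZl measurableT Theta ig) => //.
  move=> x _; rewrite -EFinM !abse_EFin lee_fin !ger0_norm ?mulr_ge0 ?(ltW Th0)//.
  by have /andP[] := bnd x.
have -> : Re (Defs.form A u u) = fine (\int[mu]_x (G x)%:E)%E by [].
rewrite EFinM fineK; last exact: integrable_fin_num.
rewrite -intg -ge0_integralZl_EFin//; last 2 first.
- by move=> x _; rewrite lee_fin.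
- exact: ltW.
apply: ge0_le_integral => //.
- by move=> x _; rewrite lee_fin.
- exact: measurable_funeM.
- move=> x _; rewrite -EFinM lee_fin mulrC -ler_pdivrMr// mulrC.
  by have /andP[] := bnd x.
Qed.

End form_bounds.

(** * Spectral measures and low energies *)

Section moments.
Context {R : realType}.
Variables (m : {measure set (measurableTypeR R) -> \bar R}) (N : R).
Hypothesis mT : m setT = N%:E.

Lemma integral_const_moment (k : R) : (\int[m]_t k%:E = (k * N)%:E)%E.
Proof. by rewrite (integral_cst m measurableT k%:E) mT EFinM. Qed.

Lemma integrable_const_moment (k : R) : m.-integrable setT (fun=> k%:E).
Proof.
apply/integrableP; split=> //.
under eq_integral do rewrite abse_EFin.
by rewrite integral_const_moment ltry.
Qed.

Lemma second_moment_lty (K : R) : m (~` `[- K, K]%classic) = 0%E ->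
  (\int[m]_t (t ^+ 2)%:E < +oo)%E.
Proof.
move=> mK; apply: (@le_lt_trans _ _ (\int[m]_t (K ^+ 2)%:E)%E); last first.
  by rewrite integral_const_moment ltry.
apply: ae_ge0_le_integral => //.
- by move=> t _; rewrite lee_fin sqr_ge0.
- by apply/measurable_EFinP; exact: measurable_funX.
- by move=> t _; rewrite lee_fin sqr_ge0.
exists (~` `[- K, K]%classic); split=> //; first by apply: measurableC; exact: measurable_itv.
move=> t /=; apply: contra_not; rewrite in_itv/= => /andP[h1 h2] _.
rewrite lee_fin -(real_normK (num_real t)) lerXn2r ?nnegrE//.
  by rewrite (le_trans (normr_ge0 t))// ler_norml h1.
by rewrite ler_norml h1.
Qed.

(** Almost everywhere t = min(t, k) <= k. The truncation is used because the
    comparison of integrals is made at every point. *)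
Lemma first_moment_le (k : R) : (\int[m]_t (t ^+ 2)%:E < +oo)%E ->
  m `]k, +oo[%classic = 0%E -> \int[m]_t t <= k * N.
Proof.
move=> m2 mk.
have i2 : m.-integrable setT (fun t : R => (t ^+ 2)%:E).
  apply/integrableP; split; first by apply/measurable_EFinP; exact: measurable_funX.
  by under eq_integral do rewrite gee0_abs ?lee_fin ?sqr_ge0//.
have i1 : m.-integrable setT (fun t : R => t%:E).
  apply: le_integrable (integrableD measurableT (integrable_const_moment 1) i2) => //.
    exact/measurable_EFinP.
  move=> t _; rewrite -EFinD !abse_EFin lee_fin [leRHS]ger0_norm ?addr_ge0 ?sqr_ge0//.
  rewrite -(real_normK (num_real t)); have := normr_ge0 t; set y := `|t|; nra.
have im : m.-integrable setT (fun t : R => (Num.min t k)%:E).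
  apply: le_integrable (integrableD measurableT (integrable_abse i1) (integrable_const_moment `|k|)) => //.
    by apply/measurable_EFinP; exact: measurable_minr.
  move=> t _; rewrite /comp abse_EFin [`|t%:E|%E]abse_EFin -EFinD abse_EFin lee_fin.
  rewrite [leRHS]ger0_norm ?addr_ge0//.
  by case: (leP t k) => _; [rewrite lerDl|rewrite lerDr].
have -> : \int[m]_t t = \int[m]_t (Num.min t k).
  congr fine; apply: ae_eq_integral => //.
  - by apply/measurable_EFinP; exact: measurable_minr.
  exists `]k, +oo[%classic; split=> //.
  move=> t /= nt; rewrite in_itv/= andbT ltNge; apply/negP => tk; apply: nt => _.
  by rewrite min_l.
have -> : k * N = \int[m]_t k by rewrite /Rintegral integral_const_moment.
apply: le_Rintegral => //; first exact: integrable_const_moment.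
by move=> t _; rewrite ge_min lexx orbT.
Qed.

End moments.

Section spectral_bounds.
Context {R : realType} {n : nat}.
Local Notation T := 'rV[R]_n.
Local Notation mu := (@lebesgue_rV R n).
Local Notation Re := complex.Re.
Local Open Scope complex_scope.
Variable E : @pvm R n.
Implicit Types (f : T -> R[i]) (B C : set (measurableTypeR R)).

Lemma pvm_inner B f : measurable B -> L2 f ->
  inner (E B f) f = inner (E B f) (E B f).
Proof.
move=> mB Lf; have Lv := pvm_L2 E mB Lf.
rewrite (pvm_selfadjoint E mB Lf Lf) [RHS](pvm_selfadjoint E mB Lf Lv).
apply: ae_eq_inner => //; [exact: pvm_L2|exact: ae_eq_refl|].
by have := pvm_setI E mB mB Lf; rewrite setIid.
Qed.

(** E(C) E(B) = E(B) when B is contained in C. *)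
Lemma pvm_measure_range B C f : measurable B -> measurable C -> B `<=` C -> L2 f ->
  pvm_measure E (E B f) C = (Re (inner (E B f) (E B f)))%:E.
Proof.
move=> mB mC BC Lf; have Lv := pvm_L2 E mB Lf.
rewrite (pvm_measureE E mC Lv); congr (Re _)%:E.
apply: ae_eq_inner => //; [exact: pvm_L2| |exact: ae_eq_refl].
have := pvm_setI E mC mB Lf; rewrite (setIidr BC) => H.
exact: ae_eq_sym.
Qed.

(** The spectral measure of a vector in the range of E(B) is carried by B: already
    B has the full mass. *)
Lemma pvm_measure_range0 B f : measurable B -> L2 f ->
  pvm_measure E (E B f) (~` B) = 0%E.
Proof.
move=> mB Lf; set m := pvm_measure E (E B f).
have E1 : m setT = (Re (inner (E B f) (E B f)))%:E by exact: pvm_measure_range.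
have E2 : m B = (Re (inner (E B f) (E B f)))%:E by exact: pvm_measure_range.
have := measureU m mB (measurableC mB) (setICr B); rewrite setUCr.
rewrite [X in X = _]E1 [X in _ = (X + _)%E -> _]E2.
set a := (Re _)%:E => H; have afin : a \is a fin_num by [].
by rewrite -[LHS](addeK _ afin) (addeC _ a) -H subee.
Qed.

Variables (A : T -> 'M[R]_n) (Theta L : R).
Hypotheses (ell : ellipticity_constant A Theta) (lipA : lipschitz_matrix L A).
Hypothesis (resE : spectral_resolution (divergence_operator A) E).

Lemma form_ge0 u : H1 u -> 0 <= Re (Defs.form A u u).
Proof.
move=> Hu; have [Th1 _] := ell; have Th0 : 0 < Theta by exact: lt_le_trans Th1.
rewrite -(pmulr_rge0 _ Th0) -lee_fin; apply: le_trans (ellipticity_gradient ell lipA Hu).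
apply: sume_ge0 => i _; apply: adde_ge0; apply: integral_ge0 => x _;
  by rewrite lee_fin sqr_ge0.
Qed.

(** The domain of the operator is where the second moment is finite, and there the
    energy is the inner product with the image, which is the first moment. *)
Lemma form_first_moment u : L2 u -> (\int[pvm_measure E u]_t (t ^+ 2)%:E < +oo)%E ->
  H1 u /\ Re (Defs.form A u u) = \int[pvm_measure E u]_t t.
Proof.
move=> Lu u2; have [dom mom] := resE.
have [f Hf] := (dom u Lu).2 u2; split; first by case: Hf.
have [Hu _ fE] := Hf; rewrite (fE u Hu) (mom u f Hf).
by [].
Qed.

(** The operator is nonnegative: a spectral piece of f carried by a compact
    interval of the negative half-line would lie in the domain and have negative
    energy. *)
Lemma pvm_measure_neg f : L2 f -> pvm_measure E f `]-oo, 0[%classic = 0%E.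
Proof.
move=> Lf.
(* Bounded from below for the second moment, and away from 0 for a strictly
   negative energy. *)
pose B (k : nat) : set (measurableTypeR R) := `[- k%:R, - k.+1%:R^-1]%classic.
have mB k : measurable (B k) by exact: measurable_itv.
have B0 k : pvm_measure E f (B k) = 0%E.
  rewrite pvm_measureE// pvm_inner//; congr EFin; apply/eqP.
  set v := E (B k) f; have Lv : L2 v by exact: pvm_L2.
  rewrite eq_le Re_inner_ge0 andbT.
  have mT : pvm_measure E v setT = (Re (inner v v))%:E by exact: pvm_measure_range.
  have k0 : (0 : R) <= k%:R by [].
  have k1 : (0 : R) < k.+1%:R^-1 by rewrite invr_gt0 ltr0n.
  have null C : measurable C -> C `<=` ~` B k -> pvm_measure E v C = 0%E.
    move=> mC CB; apply/eqP; rewrite -measure_le0 -(pvm_measure_range0 (mB k) Lf).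
    by apply: le_measure; rewrite ?inE//; exact: measurableC.
  have v2 : (\int[pvm_measure E v]_t (t ^+ 2)%:E < +oo)%E.
    apply: (second_moment_lty mT (K := k%:R)); apply: null.
      by apply: measurableC; exact: measurable_itv.
    rewrite /B; apply: subsetC => t /=; rewrite !in_itv/= => /andP[-> h]; rewrite (le_trans h)//.
    by rewrite (@le_trans _ _ 0)// oppr_le0 ltW.
  have [Hv fv] := form_first_moment Lv v2.
  have := first_moment_le mT v2 (k := - k.+1%:R^-1).
  rewrite -fv => /(_ _)/(le_trans (form_ge0 Hv)) H.
  have : 0 <= - k.+1%:R^-1 * Re (inner v v).
    apply: H; apply: null; first exact: measurable_itv.
    rewrite /B => t /=; rewrite !in_itv/= andbT => h; apply/negP; rewrite negb_and -!ltNge h.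
    by rewrite orbT.
  by rewrite mulNr oppr_ge0 pmulr_rle0.
have -> : `]-oo, 0[%classic = \bigcup_k B k.
  apply/seteqP; split=> [t|t [k _]]; rewrite /B /= !in_itv/=; last first.
    by move=> /andP[_ h]; rewrite (le_lt_trans h)// oppr_lt0 invr_gt0 ltr0n.
  move=> t0; pose K := maxn (Num.truncn (- t)).+1 (Num.truncn (- t)^-1).+1.
  have nt0 : 0 < - t by rewrite oppr_gt0.
  exists K => //=; rewrite in_itv/=; apply/andP; split.
    rewrite lerNl (le_trans (ltW (truncnS_gt (- t))))// ler_nat leq_maxl//.
  rewrite lerNr invf_ple ?posrE ?ltr0n//.
  by rewrite (le_trans (ltW (truncnS_gt _)))// ler_nat (leq_trans (leq_maxr _ _) (leqnSn _)).
apply/negligibleP; first exact: bigcupT_measurable.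
by apply: negligible_bigcup => k; apply/negligibleP; [exact: mB|exact: B0].
Qed.

(** The spectral measure of u is carried by [0, kappa]. Boundedness below matters
    as much as the bound above: it makes the second moment finite, so that u lies
    in the domain of the operator. *)
Lemma low_energy f (kappa : R) : 0 <= kappa -> L2 f ->
  let u := E `]-oo, kappa]%classic f in
  H1 u /\ Re (Defs.form A u u) <= kappa * Re (inner u u).
Proof.
move=> k0 Lf u; have mI : measurable (`]-oo, kappa]%classic : set (measurableTypeR R)) by exact: measurable_itv.
have Lu : L2 u by exact: pvm_L2.
have mT : pvm_measure E u setT = (Re (inner u u))%:E by exact: pvm_measure_range.
have above : pvm_measure E u `]kappa, +oo[%classic = 0%E.
  by have := pvm_measure_range0 mI Lf; rewrite setCitvl.
have u2 : (\int[pvm_measure E u]_t (t ^+ 2)%:E < +oo)%E.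
  apply: (second_moment_lty mT (K := kappa)).
  apply/negligibleP; first by apply: measurableC; exact: measurable_itv.
  have neg : (pvm_measure E u).-negligible `]-oo, 0[%classic.
    by apply/negligibleP; [exact: measurable_itv|exact: pvm_measure_neg].
  have pos : (pvm_measure E u).-negligible `]kappa, +oo[%classic.
    by apply/negligibleP; first exact: measurable_itv.
  apply: negligibleS (negligibleU neg pos) => t /=.
  rewrite !in_itv/= andbT => /negP; rewrite negb_and -!ltNge => /orP[h|h].
    by left; lra.
  by right.
have [Hu ->] := form_first_moment Lu u2; split=> //.
exact: first_moment_le.
Qed.

End spectral_bounds.

(** * Absorbing the gradient *)

Section constants.
Context {R : realType}.

(** Each factor of the Poincare inequality costs a power of delta: 1 / d >= delta
    turns the volume into delta^(2 d), 1 / 2 >= delta absorbs each 2^d in delta^d,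
    and Theta <= 1 / delta. After multiplication by delta^(2 d) the inequality
    reads delta^(4 d) N <= 2 Sg + 2 Theta kappa N, where kappa beats delta^(4 d)
    by enough to absorb the last term. *)
Lemma absorb_gradient (d : nat) (delta Theta N Sg kappa : R) :
  (0 < d)%N -> 0 < delta -> 330 * delta <= 1 -> d%:R * delta <= 1 ->
  0 <= Theta -> Theta * delta <= 1 -> 0 <= N -> 0 <= Sg -> 0 <= kappa ->
  kappa <= 2^-1 * delta ^+ (4 * d + 10) ->
  (delta / d%:R) ^+ d * N <=
    2 * (2 ^+ d * Sg) + 2 * (2 ^+ d * (2 ^+ d * (Theta * (kappa * N)))) ->
  kappa * N <= Sg.
Proof.
move=> d0 e0 e330 de T0 Te N0 S0 k0 kle H.
have dR : (0 : R) < d%:R by rewrite ltr0n.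
set a := delta ^+ d; set b := 2 ^+ d in H.
have a0 : 0 < a by rewrite exprn_gt0.
have b0 : 0 < b by rewrite exprn_gt0.
have a1 : a <= 1 by rewrite exprn_ile1 ?ltW//; lra.
have ab : a * b <= 1.
  by rewrite /a /b -exprMn exprn_ile1//; [rewrite mulr_ge0 ?ltW|lra].
have ab0 : 0 <= a * b by rewrite mulr_ge0 ?ltW.
have ca : a ^+ 2 <= (delta / d%:R) ^+ d.
  have base : delta ^+ 2 <= delta / d%:R.
    by rewrite ler_pdivlMr// expr2 -mulrA ler_piMr ?(ltW e0)// mulrC.
  rewrite /a -exprM mulnC exprM; apply: lerXn2r => //; rewrite nnegrE.
    exact: sqr_ge0.
  by apply: divr_ge0; exact: ltW.
have h1 : a ^+ 4 * N <= 2 * Sg + 2 * (Theta * (kappa * N)).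
  have TkN : 0 <= Theta * (kappa * N) by rewrite !mulr_ge0.
  apply: (@le_trans _ _ (a ^+ 2 * ((delta / d%:R) ^+ d * N))).
    rewrite mulrA; apply: ler_wpM2r => //.
    have -> : a ^+ 4 = a ^+ 2 * a ^+ 2 by rewrite -exprD.
    by apply: ler_wpM2l => //; rewrite exprn_ge0 ?ltW.
  apply: (@le_trans _ _ (a ^+ 2 * (2 * (b * Sg) + 2 * (b * (b * (Theta * (kappa * N))))))).
    by apply: ler_wpM2l => //; rewrite exprn_ge0 ?ltW.
  have -> : a ^+ 2 * (2 * (b * Sg) + 2 * (b * (b * (Theta * (kappa * N))))) =
      2 * (a * b * a * Sg) + 2 * ((a * b) ^+ 2 * (Theta * (kappa * N))) by ring.
  apply: lerD; apply: ler_wpM2l => //.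
    by apply: ler_piMl => //; rewrite mulr_ile1// ?ltW.
  by apply: ler_piMl => //; rewrite exprn_ile1.
have e9 : delta ^+ 9 <= 2^-1.
  rewrite exprS; apply: (@le_trans _ _ (delta * 1)); last by lra.
  by apply: ler_wpM2l; [exact: ltW|rewrite exprn_ile1 ?ltW//; lra].
(* One factor delta is spent on Theta, the others on numerical constants. *)
have kE : delta ^+ (4 * d + 10) = a ^+ 4 * delta ^+ 9 * delta.
  by rewrite addnS exprSr exprD mulnC exprM.
have a4 : 0 < a ^+ 4 by rewrite exprn_gt0.
have h2 : 2 * (Theta * kappa) <= a ^+ 4 * 2^-1.
  apply: (@le_trans _ _ (Theta * delta ^+ (4 * d + 10))).
    by rewrite mulrCA; apply: ler_wpM2l => //; lra.
  rewrite kE mulrCA.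
  apply: (@le_trans _ _ (a ^+ 4 * delta ^+ 9)); last exact: (ler_wpM2l (ltW a4)).
  by apply: ler_piMr => //; apply: mulr_ge0; apply: exprn_ge0; exact: ltW.
have h3 : kappa <= a ^+ 4 * 4^-1.
  apply: (le_trans kle); rewrite kE.
  have : a ^+ 4 * delta ^+ 9 * delta <= a ^+ 4 * 2^-1.
    rewrite -mulrA; apply: (ler_wpM2l (ltW a4)).
    by rewrite mulrC; apply: (@le_trans _ _ (1 * delta ^+ 9));
      [apply: ler_wpM2r; [rewrite exprn_ge0 ?ltW|lra]|rewrite mul1r].
  lra.
have h4 := ler_wpM2r N0 h2; have h5 := ler_wpM2r N0 h3.
have h6 : 2 * (Theta * kappa) * N = 2 * (Theta * (kappa * N)) by ring.
lra.
Qed.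

(** All factors of 1 / delta0 are at least 1, so it dominates the ones kept here.
    The threshold thus bounds the dimension and the ellipticity constant by
    1 / delta. *)
Lemma delta0_le (d : nat) (ThetaE ThetaL delta : R) : (0 < d)%N -> 1 <= ThetaE -> 0 <= ThetaL ->
  0 < delta -> delta < delta0 d ThetaE ThetaL -> 330 * d%:R * ThetaE * delta <= 1.
Proof.
move=> d0 T1 L0 e0; rewrite /delta0; have : (0 : R) < 330 by rewrite ltr0n.
move: (330 : R) => c c0.
have dR : (0 : R) < d%:R by rewrite ltr0n.
have T0 : 0 < ThetaE by exact: lt_le_trans T1.
set X := (X in X^-1) => eX.
have XT : c * d%:R * ThetaE <= X.
  rewrite /X; have e2 : 1 <= expR 2 :> R by have := expR_ge1Dx (2 : R); lra.
  have p1 : ThetaE <= ThetaE `^ (11 / 2).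
    have : ThetaE `^ 1 <= ThetaE `^ (11 / 2) by apply: ler_powR => //; lra.
    by rewrite powRr1// (ltW T0).
  have p2 : 1 <= (ThetaE + 1) `^ (5 / 2).
    have : (ThetaE + 1) `^ 0 <= (ThetaE + 1) `^ (5 / 2) by apply: ler_powR; lra.
    by rewrite powRr0.
  have d3 : 0 < c * d%:R :> R by exact: mulr_gt0.
  have s1 : c * d%:R <= c * d%:R * expR 2 :> R.
    by apply: ler_peMr => //; exact: ltW.
  have s2 : c * d%:R * ThetaE <= c * d%:R * expR 2 * ThetaE `^ (11 / 2).
    by apply: ler_pM => //; exact: ltW.
  have q0 : 0 <= c * d%:R * expR 2 * ThetaE `^ (11 / 2).
    by apply: le_trans s2; rewrite mulr_ge0 ?ltW.
  have s3 := le_trans s2 (ler_peMr q0 p2).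
  apply: (le_trans s3); rewrite ler_peMr//; last by rewrite lerDr.
  by rewrite mulr_ge0 ?powR_ge0.
have X0 : 0 < X by apply: lt_le_trans XT; do 2!apply: mulr_gt0 => //.
apply: (@le_trans _ _ (X * delta)); first by apply: ler_wpM2r => //; exact: ltW.
by rewrite mulrC -ler_pdivlMr// mul1r ltW.
Qed.

(** Adds the inequalities for the real and the imaginary part. The signs are there
    because extended reals distribute only over sums of nonnegative terms. *)
Lemma ereal_combine (b c : R) (X1 X2 Y1 Y2 Z1 Z2 : \bar R) : 0 <= b -> 0 <= c ->
  (0 <= X1 -> 0 <= X2 -> 0 <= Y1 -> 0 <= Y2 -> 0 <= Z1 -> 0 <= Z2 ->
   c%:E * X1 <= 2%:E * (b%:E * Y1) + 2%:E * (b%:E * (b%:E * Z1)) ->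
   c%:E * X2 <= 2%:E * (b%:E * Y2) + 2%:E * (b%:E * (b%:E * Z2)) ->
   c%:E * (X1 + X2) <=
     2%:E * (b%:E * (Y1 + Y2)) + 2%:E * (b%:E * (b%:E * (Z1 + Z2))))%E.
Proof.
move=> b0 c0 x1 x2 y1 y2 z1 z2 h1 h2.
have b0' : (0 <= b%:E)%E by rewrite lee_fin.
rewrite !ge0_muleDr ?mule_ge0//.
by rewrite addeACA; apply: leeD.
Qed.

End constants.

(** * Observability at low energies *)

Section observability.
Context {R : realType} {n : nat}.
Local Notation T := 'rV[R]_n.
Local Notation mu := (lebesgue_rV n : {sigma_finite_measure set T -> \bar R}).
Local Notation Re := complex.Re.
Local Notation Im := complex.Im.
Local Open Scope complex_scope.

(** The Poincare inequality for the real and the imaginary part bounds the mass of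
    u by its mass on the balls and its gradient; ellipticity and low energy bound
    the gradient by a small multiple of the mass, which is absorbed. *)
Lemma low_energy_observability (A : T -> 'M[R]_n) (Theta L delta kappa : R)
    (Z : 'rV[int]_n -> T) (u : T -> R[i]) :
  (0 < n)%N -> ellipticity_constant A Theta -> lipschitz_matrix L A ->
  0 < delta -> 330 * n%:R * Theta * delta <= 1 -> equidistributed delta Z ->
  0 <= kappa -> kappa <= 2^-1 * delta ^+ (4 * n + 10) ->
  H1 u -> Re (Defs.form A u u) <= kappa * Re (inner u u) ->
  kappa * Re (inner u u) <=
    Re (inner (mult_indicator (equidistributed_set delta Z) u) u).
Proof.
move=> n0 ell lipA e0 esmall eqZ k0 kle Hu energy.
have [Th1 _] := ell; have Th0 : 0 <= Theta by exact: le_trans Th1.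
have n1 : (1 : R) <= n%:R by rewrite ler1n.
have nR : (0 : R) < n%:R by rewrite ltr0n.
have [Lu _] := Hu; have [[mR sR] [mI sI]] := (L2_square_integrable u).1 Lu.
have mS := measurable_equidistributed_set delta Z.
have [EW _] := inner_mult_indicator mS Lu.
have Eu := integral_Re_inner_sqr Lu.
have grad := ellipticity_gradient ell lipA Hu.
have sw i := (L2_square_integrable _).1 (dH1P i Hu).1.
have PR := poincare n0 e0 eqZ (conj mR sR) (fun i => (sw i).1)
  (fun i => weak_partial_Re (dH1P i Hu).2).
have PI := poincare n0 e0 eqZ (conj mI sI) (fun i => (sw i).2)
  (fun i => weak_partial_Im (dH1P i Hu).2).
have sq0 (g : T -> R) : (0 <= \int[mu]_x (g x ^+ 2)%:E)%E.
  by apply: integral_ge0 => x _; rewrite lee_fin sqr_ge0.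
have ind0 (g : T -> R) : (0 <= \int[mu]_x (\1_(equidistributed_set delta Z) x * g x ^+ 2)%:E)%E.
  by apply: integral_ge0 => x _; rewrite lee_fin mulr_ge0 ?sqr_ge0// indicE.
have b0 : (0 : R) <= 2 ^+ n by rewrite exprn_ge0.
have c0 : 0 <= (delta / n%:R) ^+ n by rewrite exprn_ge0// divr_ge0// ltW.
have sum0 (g : 'I_n -> T -> R) : (0 <= \sum_i \int[mu]_x (g i x ^+ 2)%:E)%E.
  by apply: sume_ge0 => i _; exact: sq0.
have := ereal_combine b0 c0 (sq0 _) (sq0 _) (ind0 _) (ind0 _) (sum0 _) (sum0 _) PR PI.
rewrite -Eu -EW -big_split => H.
set N := Re (inner u u) in Eu energy H *.
set Sg := Re (inner _ u) in EW H *.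
have N0 : 0 <= N by exact: Re_inner_ge0.
have S0 : 0 <= Sg by rewrite -lee_fin EW adde_ge0.
have grad' : (\sum_i (\int[mu]_x (Re (dH1 i u x) ^+ 2)%:E + \int[mu]_x (Im (dH1 i u x) ^+ 2)%:E) <=
    (Theta * (kappa * N))%:E)%E.
  by apply: (le_trans grad); rewrite lee_fin; exact: ler_wpM2l.
have {}H : ((delta / n%:R) ^+ n * N <= 2 * (2 ^+ n * Sg) +
    2 * (2 ^+ n * (2 ^+ n * (Theta * (kappa * N)))))%R.
  rewrite -lee_fin; apply: (@le_trans _ _ (((delta / n%:R) ^+ n)%:E * N%:E)%E).
    by rewrite -EFinM.
  apply: (le_trans H); rewrite [leRHS]EFinD; apply: leeD; first by rewrite -!EFinM.
  rewrite [leRHS]EFinM; apply: lee_wpmul2l => //.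
  by do 2!(rewrite [leRHS]EFinM; apply: lee_wpmul2l; first by rewrite lee_fin).
have {}esmall : 330 * (n%:R * Theta * delta) <= 1 by rewrite !mulrA.
have le1 : 1 * delta <= n%:R * Theta * delta.
  by apply: ler_wpM2r; [exact: ltW|rewrite -[leLHS]mulr1; apply: ler_pM].
have le2 : n%:R * delta <= n%:R * Theta * delta.
  by apply: ler_wpM2r; [exact: ltW|apply: ler_peMr => //; exact: ltW].
have le3 : Theta * delta <= n%:R * Theta * delta.
  by apply: ler_wpM2r; [exact: ltW|apply: ler_peMl].
by apply: (absorb_gradient n0 e0 _ _ Th0 _ N0 S0 k0 kle H); lra.
Qed.

End observability.

Local Open Scope complex_scope.

Theorem corollary3p11 (R : realType) (d : nat) (d_gt0 : (0 < d)%N) :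
  exists2 M : R, 0 < M &
  forall (thEm thEp thL : R)
    (thEm_gt0 : 0 < thEm) (thEp_gt0 : 0 < thEp) (thL_gt0 : 0 < thL)
    (tA : 'rV[R]_d -> 'M[R]_d)
    (tA_sym : forall x, (tA x)^T = tA x)
    (tA_ell : quadratic_bounds thEm thEp tA)
    (tA_lip : lipschitz_matrix thL tA)
    (F : 'rV[R]_d -> 'rV[R]_d) (F_lip : lipschitz_euclid F),
  let A := tA \o F in
  forall (ThetaE ThetaL : R)
    (A_ell : ellipticity_constant A ThetaE)
    (A_lip : lipschitz_constant A ThetaL)
    (delta : R) (delta_bounds : 0 < delta < delta0 d ThetaE ThetaL)
    (Z : 'rV[int]_d -> 'rV[R]_d) (Z_equi : equidistributed delta Z)
    (E : pvm) (E_res : spectral_resolution (divergence_operator A) E),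
  let kappa := 2^-1 * delta `^ (M * (1 + thEm `^ (- (2 / 3)))) in
  let I := [set` `]-oo, kappa]] in
  let W := mult_indicator (equidistributed_set delta Z) in
  op_le (fun f x => kappa%:C * E I f x) (fun f => E I (W (E I f))).
Proof.
exists (4 * d + 10)%:R; first by rewrite ltr0n addnS.
move=> thEm _ _ _ _ _ tA _ _ _ F _ A ThetaE ThetaL ell [ThL0 lip] delta /andP[e0 e1].
move=> Z eqZ E resE kappa I W f Lf.
have esmall := delta0_le d_gt0 ell.1 ThL0 e0 e1.
have mI : measurable (I : set (measurableTypeR R)) by exact: measurable_itv.
have k0 : 0 <= kappa by rewrite mulr_ge0 ?powR_ge0// invr_ge0.
have delta1 : delta <= 1.
  apply: le_trans esmall; apply: ler_peMl; first exact: ltW.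
  apply: mulr_ege1; last exact: ell.1.
  by apply: mulr_ege1; rewrite ler1n.
(* The exponent is at least M, and delta <= 1. *)
have kle : kappa <= 2^-1 * delta ^+ (4 * d + 10).
  rewrite /kappa ler_pM2l ?invr_gt0// -powR_mulrn ?(ltW e0)//.
  apply: ger_powR; first by rewrite e0.
  by rewrite ler_peMr// lerDl powR_ge0.
have [Hu energy] := low_energy ell lip resE k0 Lf.
set u := E I f; have Lu : L2 u by exact: pvm_L2.
have mS := measurable_equidistributed_set delta Z.
have LW : L2 (W u) by exact: L2_mult_indicator.
rewrite (pvm_selfadjoint E mI LW Lf) inner_real_scale// pvm_inner// -/u.
have [_ ImW] := inner_mult_indicator mS Lu.
rewrite inner_selfE -rmorphM lecE ImW.
have obs := low_energy_observability d_gt0 ell lip e0 esmall eqZ k0 kle Hu energy.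
by apply/andP; split; [exact: eqxx|exact: obs].
Qed.
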